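(* Let $n\ge2$ and $1\le k\le n$. Let $Y=(Y_1,\ldots,Y_n)$ be a random vector in $\mathbb{R}^n$ whose distribution is spherically symmetric (for every fixed orthogonal $n\times n$ matrix $U$, $UY$ has the same distribution as $Y$), normalized so that $\mathbb{E}Y_1^2=1$, and suppose that $a$ is a constant with $$\operatorname{Var}(|Y|^2)\le a .$$ Let $P_k(Y)=(Y_1,\ldots,Y_k)$ and let $Z$ be a standard Gaussian random vector in $\mathbb{R}^k$. Then $$d_W(P_k(Y),Z)\le\frac{k(\sqrt a+2)}{n-1}.$$
   Context: $|\cdot|$ is the Euclidean norm. The Wasserstein distance between random vectors $X,Y$ in $\mathbb{R}^k$ is $d_W(X,Y)=\sup\left|\mathbb{E}g(X)-\mathbb{E}g(Y)\right|$, the supremum being over functions $g:\mathbb{R}^k\to\mathbb{R}$ with Lipschitz constant (with respect to the Euclidean norm) at most $1$. *)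

(* Defs.v *)
From HB Require Import structures.
From mathcomp Require Import all_boot all_order all_algebra.
From mathcomp Require Import all_classical all_reals all_analysis.

Set Implicit Arguments.
Unset Strict Implicit.
Unset Printing Implicit Defensive.

Import Order.TTheory GRing.Theory Num.Theory.
Import numFieldNormedType.Exports.

Local Open Scope classical_set_scope.
Local Open Scope ring_scope.

(* Vectors of R^n are n-tuples: [n.-tuple R] carries the product of the Borel
   sigma-algebras of R, so that random vectors are [{RV P >-> n.-tuple R}]. *)
Section vectors.
Context {R : realType}.

(* The library norm on matrices is the sup norm, hence this definition. *)
Definition enorm n (x : n.-tuple R) : R :=
  Num.sqrt (\sum_(i < n) tnth x i ^+ 2).

Definition tsub n (x y : n.-tuple R) : n.-tuple R :=
  [tuple tnth x i - tnth y i | i < n].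

Definition mxact n (U : 'M[R]_n) (x : n.-tuple R) : n.-tuple R :=
  [tuple (U *m \col_(j < n) tnth x j) i 0 | i < n].

Definition orthogonal_mx n (U : 'M[R]_n) : Prop := U *m U^T = 1%:M.

Definition first_coords k n (kn : (k <= n)%N) (x : n.-tuple R) : k.-tuple R :=
  [tuple tnth x (widen_ord kn i) | i < k].

Definition lipschitz1 k (g : k.-tuple R -> R) : Prop :=
  forall x y, `|g x - g y| <= enorm (tsub x y).

End vectors.

(* The laws are compared on measurable sets only, since the values of a
   measure on other sets are arbitrary. *)
Definition spherically_symmetric d (T : measurableType d) (R : realType)
    (P : probability T R) n (Y : {RV P >-> n.-tuple R}) : Prop :=
  forall U : 'M[R]_n, orthogonal_mx U ->
  forall A : set (n.-tuple R), measurable A ->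
    P ((mxact U \o Y) @^-1` A) = P (Y @^-1` A).

(* Independent N(0,1) coordinates. Taking some of the A i to be setT yields
   the product rule for every subfamily of the coordinates. *)
Definition standard_gaussian d (T : measurableType d) (R : realType)
    (P : probability T R) k (Z : {RV P >-> k.-tuple R}) : Prop :=
  (forall (i : 'I_k) (A : set R), measurable A ->
     P [set w | A (tnth (Z w) i)] = normal_prob 0 1 A) /\
  (forall A : 'I_k -> set R, (forall i, measurable (A i)) ->
     P [set w | forall i, A i (tnth (Z w) i)] =
     (\prod_(i < k) P [set w | A i (tnth (Z w) i)])%E).

(* The two vectors may live on different probability spaces. *)
Definition wasserstein d d' (T : measurableType d) (T' : measurableType d')
    (R : realType) (P : probability T R) (Q : probability T' R) k
    (X : T -> k.-tuple R) (Y : T' -> k.-tuple R) : \bar R :=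
  ereal_sup [set `| 'E_P[g \o X] - 'E_Q[g \o Y] |%E | g in lipschitz1 (k := k)].

(* Main.v *)
Require Import Defs.
From mathcomp Require Import all_boot all_order all_algebra.
From mathcomp Require Import all_classical all_reals all_analysis.
From mathcomp Require Import measurable_realfun ring lra.

Set Implicit Arguments.
Unset Strict Implicit.
Unset Printing Implicit Defensive.

Import Order.TTheory GRing.Theory Num.Theory.
Import numFieldNormedType.Exports.

Local Open Scope classical_set_scope.
Local Open Scope ring_scope.

(** Let X = P_k(Y), with Y and Z on a common product space, and
    S(x) = cos x X + sin x Z, which goes from X to Z as x runs from 0 to pi/2.
    After convolution with a small Gaussian, g is differentiable, its gradient
    G has norm at most 1 and is Lipschitz, and
      d/dx E[g(S)] = cos x E[Z.G(S)] - sin x E[X.G(S)].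
    Gaussian integration by parts gives sin x E[Y_i G_i(S)] = E[Z_i Y_i g(S)].
    Infinitesimal rotations of the plane (i, j) preserve the law of Y, and
    applied to Z_i Y_j g(S) they give, for every j <> i,
      E[Z_i Y_i g(S)] = cos x E[(Y_j G_i(S) - Y_i G_j(S)) Z_i Y_j].
    Summing over i and j,
      (n - 1) d/dx E[g(S)] =
        cos x E[(n - 1 - |Y|^2) Z.G(S) + (X.Z) (X.G(S))].
    By Cauchy-Schwarz the last expectation is at most
    sqrt((a + 1) k) + k <= k (sqrt a + 2), and cos integrates to 1. *)

(** No derivative is taken under an integral sign. Means are compared before and after a
    displacement of size t (a translation of one Gaussian coordinate, a rotation of Y, a step along
    the path), and the deviation from the first-order term is bounded by a multiple of t^2;
    [eq0_small_bound] is the limit after division by t. The source of the cancellation: each of the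
    n - 1 coordinate planes containing axis i yields the same left-hand side, and adding them puts
    |Y|^2 where n - 1 stood. These are close, because |Y|^2 has mean n and variance at most a, so
    that E(n - 1 - |Y|^2)^2 <= a + 1. The constraint is integrability. The variance bound supplies
    four moments of each coordinate of Y and no more, so every integrand is kept at polynomial
    degree at most 4 in (Y, Z); this is the role of the degree in [tame]. The gradient of the
    mollified function has to be bounded in Euclidean norm, not coordinatewise: this keeps |Z.G| <=
    |Z| and |X.G| <= |X|, hence a factor k and not a larger power of k. *)

Lemma eq0_small_bound {R : realFieldType} (a C : R) :
  (forall t, 0 < t -> t <= 1 -> `|a| <= C * t) -> a = 0.
Proof.
move=> H; apply/eqP; rewrite -normr_le0 leNgt; apply/negP => a0.
have C0 : 0 < C by have := H 1 ltr01 (lexx _); rewrite mulr1; apply: lt_le_trans.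
pose t := Num.min 1 (`|a| / (2 * C)).
have t0 : 0 < t by rewrite lt_min ltr01/= divr_gt0// mulr_gt0.
have t1 : t <= 1 by rewrite ge_min lexx.
have := H t t0 t1; apply/negP; rewrite -ltNge.
have : t <= `|a| / (2 * C) by rewrite ge_min lexx orbT.
rewrite ler_pdivlMr ?mulr_gt0//; lra.
Qed.

(** The inequality 1 + v <= exp v at v = u and v = -u is enough. At -u it gives exp u - 1 <= u exp
    u, that is, exp u - 1 - u <= u (exp u - 1). For u >= 0 the same bound is used once more; for u <
    0, u <= exp u - 1 is multiplied by u. *)
Lemma expR_taylor2 {R : realType} (u : R) :
  `|expR u - 1 - u| <= u ^+ 2 * expR `|u|.
Proof.
have h1 := expR_ge1Dx u; have h2 := expR_ge1Dx (- u).
have e0 := expR_gt0 u.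
have eN : expR u * expR (- u) = 1 by rewrite -expRD subrr expR0.
have h3 : expR u * (1 - u) <= 1 by rewrite -[leRHS]eN ler_pM2l.
rewrite ger0_norm; last lra.
have h4 : expR u - 1 - u <= u * (expR u - 1) by lra.
apply: (le_trans h4); have [u0|u0] := leP 0 u.
  by rewrite ger0_norm// expr2 -mulrA ler_wpM2l//; lra.
have h5 : 1 <= expR `|u|.
  by have := expR_ge1Dx `|u|; have := normr_ge0 u; lra.
apply: (@le_trans _ _ (u ^+ 2)); last by rewrite ler_peMr// sqr_ge0.
by rewrite expr2 ler_nM2l//; lra.
Qed.

(** * Integrals of real-valued functions *)

Section real_integral.
Context d (T : measurableType d) (R : realType).
Variable mu : {measure set T -> \bar R}.
Implicit Types (f g : T -> R) (c : R).
Local Notation integrableR f := (mu.-integrable setT (EFin \o f)).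
Local Notation E f := (\int[mu]_x f x).

Lemma integrableRD f g : integrableR f -> integrableR g ->
  integrableR (fun x => f x + g x).
Proof. by move=> fi gi; exact: (integrableD measurableT fi gi). Qed.

Lemma integrableRN f : integrableR f -> integrableR (fun x => - f x).
Proof. by move=> fi; exact: (integrableN fi). Qed.

Lemma integrableRB f g : integrableR f -> integrableR g ->
  integrableR (fun x => f x - g x).
Proof. by move=> fi gi; apply: integrableRD => //; exact: integrableRN. Qed.

Lemma integrableRZ c f : integrableR f -> integrableR (fun x => c * f x).
Proof.
move=> fi; exact: (eq_integrable _ _ _ _ (integrableZl measurableT c fi)).
Qed.

Lemma integrableR_sum (I : Type) (r : seq I) (P : pred I) (f : I -> T -> R) :
  (forall i, integrableR (f i)) ->
  integrableR (fun x => \sum_(i <- r | P i) f i x).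
Proof.
move=> fi; elim: r => [|i r IH].
  rewrite (_ : _ \o _ = cst 0%E); first exact: integrable0.
  by apply/funext => x /=; rewrite big_nil.
rewrite (_ : (fun x => _) = (fun x => (if P i then f i x else 0) +
    \sum_(i <- r | P i) f i x)); last first.
  by apply/funext => x; rewrite big_cons; case: ifP => // _; rewrite add0r.
apply: integrableRD => //; case: (P i) => //.
exact: (integrable0 mu setT).
Qed.

Lemma le_integrableR f g : measurable_fun setT f ->
  (forall x, `|f x| <= g x) -> integrableR g -> integrableR f.
Proof.
move=> mf fg; apply: le_integrable => //; first exact/measurable_EFinP.
by move=> x _; rewrite /= lee_fin (le_trans (fg x))// ler_norm.
Qed.

Lemma RintegralTD f g : integrableR f -> integrableR g ->
  E (fun x => f x + g x) = E f + E g.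
Proof. exact: RintegralD. Qed.

Lemma RintegralTB f g : integrableR f -> integrableR g ->
  E (fun x => f x - g x) = E f - E g.
Proof. exact: RintegralB. Qed.

Lemma RintegralTZ c f : integrableR f -> E (fun x => c * f x) = c * E f.
Proof. exact: RintegralZl. Qed.

Lemma RintegralT_sum (I : Type) (r : seq I) (P : pred I) (f : I -> T -> R) :
  (forall i, integrableR (f i)) ->
  E (fun x => \sum_(i <- r | P i) f i x) = \sum_(i <- r | P i) E (f i).
Proof.
move=> fi; elim: r => [|i r IH].
  under eq_Rintegral do rewrite big_nil.
  by rewrite big_nil Rintegral_cst// mul0r.
under eq_Rintegral do rewrite big_cons.
rewrite big_cons; case: ifP => // _.
by rewrite RintegralTD ?IH//; exact: integrableR_sum.
Qed.

Lemma eq_RintegralT f g : f =1 g -> E f = E g.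
Proof. by move=> fg; apply: eq_Rintegral => x _. Qed.

Lemma le_RintegralT f g : integrableR f -> integrableR g ->
  (forall x, f x <= g x) -> E f <= E g.
Proof. by move=> fi gi fg; exact: le_Rintegral. Qed.

Lemma norm_RintegralT f g : integrableR f -> integrableR g ->
  (forall x, `|f x| <= g x) -> `|E f| <= E g.
Proof.
move=> fi gi fg; apply: (le_trans (le_normr_Rintegral measurableT fi)).
apply: le_RintegralT => //; exact: integrable_norm.
Qed.

End real_integral.

Lemma integrableR_cst d (T : measurableType d) (R : realType)
    (P : probability T R) (c : R) : P.-integrable setT (EFin \o cst c).
Proof. exact: finite_measure_integrable_cst. Qed.

Lemma RintegralT_cst d (T : measurableType d) (R : realType)
    (P : probability T R) (c : R) : \int[P]_x c = c.
Proof.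
rewrite Rintegral_cst// -[RHS]mulr1 -[1]/(fine 1%E); congr (_ * fine _).
exact: probability_setT.
Qed.

(** * The shift of the standard normal law *)

Section density.
Context d (T : measurableType d) (R : realType).
Variables (mu nu : {measure set T -> \bar R}) (p : T -> R).
Hypotheses (mp : measurable_fun setT p) (p0 : forall x, 0 <= p x).
Hypothesis nuE : forall A, measurable A -> nu A = (\int[mu]_(x in A) (p x)%:E)%E.

Import HBNNSimple.

Lemma nnsfun_integral_density (h : {nnsfun T >-> R}) :
  (\int[nu]_x (h x)%:E = \int[mu]_x (h x * p x)%:E)%E.
Proof.
have m1 r : measurable_fun setT (fun x => r * \1_(h @^-1` [set r]) x).
  by apply: measurable_funM => //; exact/measurable_indic.
have ge01 r x : 0 <= r * \1_(h @^-1` [set r]) x.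
  have [<-|nrx] := eqVneq (h x) r; first by rewrite mulr_ge0// indicE.
  by rewrite indicE memNset ?mulr0//= => /eqP; rewrite (negbTE nrx).
transitivity (\sum_(r \in range h)
    \int[nu]_x (r * \1_(h @^-1` [set r]) x)%:E)%E.
  under eq_integral do rewrite fimfunE -fsumEFin//.
  by rewrite ge0_integral_fsum// => r *;
    [exact/measurable_EFinP|rewrite lee_fin].
under [in RHS]eq_integral do rewrite fimfunE mulrC mulr_fsumr -fsumEFin//.
rewrite ge0_integral_fsum//; last 2 first.
- by move=> r; apply/measurable_EFinP/measurable_funM.
- by move=> r x _; rewrite lee_fin mulr_ge0.
apply: eq_fsbigr => r; rewrite inE => -[y _ <-{r}].
rewrite integralZl_indic_nnsfun// integral_indic//= setIT nuE//.
under [in RHS]eq_integral do rewrite mulrCA EFinM.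
rewrite ge0_integralZl//=; last 3 first.
- by apply/measurable_EFinP/measurable_funM => //; exact/measurable_indic.
- by move=> x _; rewrite lee_fin mulr_ge0.
- by rewrite lee_fin.
congr (_ * _)%E; rewrite [LHS]integral_mkcond; apply: eq_integral => x _.
by rewrite patchE indicE; case: ifP; rewrite ?mulr1 ?mulr0.
Qed.

(** Monotone convergence is applied on both sides to the same simple approximations: multiplication
    by the nonnegative [p] keeps the sequence monotone. *)
Lemma ge0_integral_density (f : T -> R) :
  measurable_fun setT f -> (forall x, 0 <= f x) ->
  (\int[nu]_x (f x)%:E = \int[mu]_x (f x * p x)%:E)%E.
Proof.
move=> mf f0.
have mEf : measurable_fun setT (EFin \o f) by exact/measurable_EFinP.
have f0' x : [set: T] x -> (0 <= (EFin \o f) x)%E by rewrite lee_fin.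
pose g := nnsfun_approx measurableT mEf.
have gf x : (EFin \o g ^~ x) @ \oo --> (f x)%:E by exact: cvg_nnsfun_approx.
have gmono x m n : (m <= n)%N -> g m x <= g n x.
  by move=> mn; exact/lefP/nd_nnsfun_approx.
transitivity (limn (fun n => (\int[nu]_x (g n x)%:E)%E)).
  rewrite -monotone_convergence//.
  - by apply: eq_integral => x _; apply/esym/cvg_lim => //; exact: gf.
  - by move=> n; exact/measurable_EFinP.
  - by move=> n x _; rewrite lee_fin.
  - by move=> x _ m n mn; rewrite lee_fin gmono.
under eq_fun do rewrite nnsfun_integral_density.
rewrite -monotone_convergence//.
- apply: eq_integral => x _; apply/cvg_lim => //.
  under eq_fun do rewrite EFinM; rewrite EFinM.
  by apply: cvgeZr => //; exact: gf.
- by move=> n; exact/measurable_EFinP/measurable_funM.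
- by move=> n x _; rewrite lee_fin mulr_ge0.
- by move=> x _ m n mn; rewrite lee_fin ler_wpM2r// gmono.
Qed.

End density.

Section normal1d.
Context {R : realType}.
Local Notation leb := (@lebesgue_measure R).
Local Notation N := (@normal_prob R 0 1).
Implicit Types (h : R -> R) (t x : R).

(** The image of Lebesgue measure under a translation gives half-open intervals their length, and
    this determines it. *)
Lemma ge0_integral_lebesgue_shift (f : R -> R) t :
  measurable_fun setT f -> (forall x, 0 <= f x) ->
  (\int[leb]_x (f (x + t)%R)%:E = \int[leb]_x (f x)%:E)%E.
Proof.
move=> mf f0.
have mt : measurable_fun [set: measurableTypeR R]
    ((fun x => x + t) : measurableTypeR R -> measurableTypeR R).
  by apply: measurable_funD.
have mEf : measurable_fun [set: measurableTypeR R] (EFin \o f).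
  exact/measurable_EFinP.
have := @ge0_integral_pushforward _ _ _ _ R _ mt leb setT _ measurableT mEf.
rewrite preimage_setT => /(_ _) H.
rewrite -[LHS]H; last by move=> y _; rewrite lee_fin.
apply: eq_measure_integral => A mA _.
apply/esym/(@lebesgue_measure_unique R (pushforward leb _)) => //.
move=> _ [[a b]] /= _ <-.
rewrite /pushforward /=.
rewrite [X in _ = _ X](_ : _ = `]a - t, b - t]%classic); last first.
  by apply/seteqP; split => x /=; rewrite !in_itv/= ltrBlDr lerBrDr.
rewrite !lebesgue_measure_itv/= !lte_fin ltrD2r.
by case: ifP => // _; rewrite -!EFinB; congr EFin; ring.
Qed.

Lemma ge0_integral_normal_prob (f : R -> R) :
  measurable_fun setT f -> (forall x, 0 <= f x) ->
  (\int[N]_x (f x)%:E = \int[leb]_x (f x * normal_pdf 0 1 x)%:E)%E.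
Proof.
move=> mf f0; apply: ge0_integral_density => //.
- exact: measurable_normal_pdf.
- by move=> x; exact: normal_pdf_ge0.
Qed.

(** The Cameron-Martin formula in dimension one: the normal density at x - t is the density at x
    times exp(t x - t^2 / 2). *)
Lemma ge0_integral_normal_prob_shift (f : R -> R) t :
  measurable_fun setT f -> (forall x, 0 <= f x) ->
  (\int[N]_x (f (x + t)%R)%:E =
   \int[N]_x (f x * expR (t * x - t ^+ 2 / 2))%:E)%E.
Proof.
move=> mf f0.
have mt : measurable_fun [set: R] (fun x => x - t) by exact: measurable_funB.
have mt' : measurable_fun [set: R] (fun x => x + t) by exact: measurable_funD.
rewrite ge0_integral_normal_prob//; last exact: measurableT_comp.
rewrite ge0_integral_normal_prob//; last 2 first.
- apply: measurable_funM => //; apply: measurableT_comp => //.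
  by apply: measurable_funB => //; exact: measurable_funM.
- by move=> x; rewrite mulr_ge0// expR_ge0.
rewrite -[RHS](@ge0_integral_lebesgue_shift _ t); last 2 first.
- apply: measurable_funM; last exact: measurable_normal_pdf.
  apply: measurable_funM => //; apply: measurableT_comp => //.
  by apply: measurable_funB => //; exact: measurable_funM.
- by move=> x; rewrite !mulr_ge0// ?expR_ge0 ?normal_pdf_ge0.
apply: eq_integral => x _; congr EFin; rewrite -mulrA; congr (_ * _).
rewrite !normal_pdfE ?oner_neq0// mulrCA /normal_fun -expRD; congr (_ * expR _).
by field.
Qed.

End normal1d.

(** * Stein's identity for the standard normal law *)

Section normal_stein.
Context {R : realType}.
Local Notation N := (@normal_prob R 0 1).
Local Notation EN f := (\int[N]_x f x).
Implicit Types (h : R -> R) (b t x : R).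

Lemma integrable_normal_expR b :
  N.-integrable setT (EFin \o (fun x : R => expR (b * `|x|))).
Proof.
have mb c : measurable_fun [set: R] (fun x => expR (c * x)).
  by apply: measurableT_comp => //; exact: measurable_funM.
have fin c : (\int[N]_x (expR (c * x))%:E < +oo)%E.
  (* The shift formula for the constant exp(c^2 / 2) cancels the quadratic term of its weight, and
     so evaluates the Laplace transform at c. *)
  have mc : measurable_fun [set: R] (cst (expR (c ^+ 2 / 2)) : R -> R) by [].
  have := ge0_integral_normal_prob_shift c mc (fun=> expR_ge0 _).
  rewrite /= integral_cst//=.
  under eq_integral => x _ do rewrite -expRD addrC subrK.
  by move=> <-; rewrite probability_setT mule1 ltry.
have mab : measurable_fun [set: measurableTypeR R]
    (fun x : R => expR (b * `|x|)).
  by apply: measurableT_comp => //; apply: measurable_funM => //;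
     exact: measurableT_comp.
apply/integrableP; split; first exact/measurable_EFinP.
apply: (@le_lt_trans _ _
    (\int[N]_x ((expR (b * x))%:E + (expR (- b * x))%:E))%E).
  apply: ge0_le_integral => //.
  - exact/measurable_EFinP/measurableT_comp.
  - by apply: emeasurable_funD; apply/measurable_EFinP; exact: mb.
  - move=> x _; rewrite /= lee_fin ger0_norm ?expR_ge0//.
    have [x0|x0] := leP 0 x; first by rewrite (ger0_norm x0) lerDl expR_ge0.
    by rewrite (ltr0_norm x0) mulNr mulrN lerDr expR_ge0.
rewrite ge0_integralD//.
- by rewrite lte_add_pinfty.
- by apply/measurable_EFinP; exact: mb.
- by apply/measurable_EFinP; exact: mb.
Qed.

Lemma integrable_normal h C b : measurable_fun setT h ->
  (forall x, `|h x| <= C * expR (b * `|x|)) ->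
  N.-integrable setT (EFin \o h).
Proof.
move=> mh hC.
apply: (@le_integrableR _ (measurableTypeR R) R N h _ mh hC).
by apply: integrableRZ; exact: integrable_normal_expR.
Qed.

(** The signed function is written as (h + k) - k with k(x) = C exp(b |x|). Both terms are
    nonnegative and the growth bound makes both integrable, so the formula for nonnegative functions
    applies to each. *)
Lemma normal_shift h C b t : measurable_fun setT h -> 0 <= b ->
  (forall x, `|h x| <= C * expR (b * `|x|)) ->
  EN (fun x => h (x + t)) = EN (fun x => h x * expR (t * x - t ^+ 2 / 2)).
Proof.
move=> mh b0 hC.
have C0 : 0 <= C.
  by have := hC 0; rewrite normr0 mulr0 expR0 mulr1; apply: le_trans.
pose k (x : R) := C * expR (b * `|x|).
have mn : measurable_fun [set: R] (fun x : R => `|x|) by exact: measurableT_comp.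
have mk : measurable_fun setT k.
  by apply: measurable_funM => //; apply: measurableT_comp => //;
     exact: measurable_funM.
have k0 x : 0 <= k x by rewrite mulr_ge0// expR_ge0.
have mt : measurable_fun [set: R] (fun x => x + t) by exact: measurable_funD.
have mw : measurable_fun [set: R] (fun x => expR (t * x - t ^+ 2 / 2)).
  by apply: measurableT_comp => //; apply: measurable_funB => //;
     exact: measurable_funM.
have le_shift x : expR (b * `|x + t|) <= expR (b * `|t|) * expR (b * `|x|).
  by rewrite -expRD ler_expR -mulrDr ler_wpM2l// addrC ler_normD.
have w_le x : expR (t * x - t ^+ 2 / 2) <= expR (`|t| * `|x|).
  rewrite ler_expR -normrM (le_trans _ (ler_norm _))// gerBl.
  by rewrite divr_ge0// sqr_ge0.
have ish (f : R -> R) : measurable_fun setT f -> (forall x, `|f x| <= k x) ->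
    N.-integrable setT (EFin \o (fun x => f (x + t))).
  move=> mf fk; apply: (@integrable_normal _ (C * expR (b * `|t|)) b).
    exact: measurableT_comp.
  move=> x; rewrite (le_trans (fk _))// /k -mulrA ler_wpM2l//.
have iw (f : R -> R) : measurable_fun setT f -> (forall x, `|f x| <= k x) ->
    N.-integrable setT (EFin \o (fun x => f x * expR (t * x - t ^+ 2 / 2))).
  move=> mf fk; apply: (@integrable_normal _ C (b + `|t|)).
    exact: measurable_funM.
  move=> x; rewrite normrM (@ger0_norm _ (expR _)) ?expR_ge0//.
  by rewrite [leRHS](_ : _ = k x * expR (`|t| * `|x|)) ?ler_pM// ?expR_ge0// mulrDl expRD mulrA.
have nk x : `|k x| <= k x by rewrite ger0_norm.
have hk0 x : 0 <= h x + k x.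
  by have := hC x; rewrite -/(k x) ler_norml => /andP[] *; lra.
have s1 := ge0_integral_normal_prob_shift t (measurable_funD mh mk) hk0.
have s2 := ge0_integral_normal_prob_shift t mk k0.
have -> : EN (fun x => h (x + t)) =
    EN (fun x => (h (x + t) + k (x + t))) - EN (fun x => k (x + t)).
  rewrite -RintegralB//; [|apply: integrableRD; exact: ish| exact: ish].
  by apply: eq_Rintegral => x _; rewrite addrK.
rewrite /Rintegral s1 s2 -/(Rintegral _ _ _) -/(Rintegral _ _ _).
rewrite -RintegralB//.
- by apply: eq_Rintegral => x _; rewrite mulrDl addrK.
- under eq_fun do rewrite mulrDl.
  by apply: integrableRD; exact: iw.
- exact: iw.
Qed.

Lemma ler_norm_expR x : `|x| <= expR `|x|.
Proof. by rewrite (le_trans _ (expR_ge1Dx _))// lerDr. Qed.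

(** With u = t x - t^2 / 2, the bound |u| <= |t| (|x| + 1) gives u^2 <= t^2 exp(2 |x|), and |u| <=
    |x| + 1 gives exp |u| <= exp(1) exp |x|. Their product is the term exp(1) exp(3 |x|) from
    [expR_taylor2]; the added 1 in the constant absorbs t^2 / 2. *)
Lemma normal_shift_remainder t x : `|t| <= 1 ->
  `|expR (t * x - t ^+ 2 / 2) - 1 - t * x| <=
  t ^+ 2 * ((expR 1 + 1) * expR (3 * `|x|)).
Proof.
move=> t1; set u := t * x - t ^+ 2 / 2.
have -> : expR u - 1 - t * x = (expR u - 1 - u) - t ^+ 2 / 2 by rewrite /u; ring.
have x0 := normr_ge0 x; have t0 := normr_ge0 t.
have tt : t ^+ 2 = `|t| ^+ 2 by rewrite real_normK ?num_real.
have u1 : `|u| <= `|t| * (`|x| + 1).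
  rewrite (le_trans (ler_normB _ _))// mulrDr mulr1 normrM lerD2l.
  rewrite ger0_norm ?divr_ge0 ?sqr_ge0// tt; nra.
have u2 : `|u| <= `|x| + 1 by rewrite (le_trans u1)// ler_piMl// addr_ge0.
have e0 := expR_ge1Dx `|x|.
have u3 : u ^+ 2 <= t ^+ 2 * expR (2 * `|x|).
  rewrite tt -[u ^+ 2]real_normK ?num_real// expRM_natl -exprMn.
  rewrite lerXn2r ?nnegrE ?mulr_ge0 ?expR_ge0//.
  by rewrite (le_trans u1)// ler_wpM2l// addrC.
rewrite (le_trans (ler_normB _ _))// mulrDl mul1r mulrDr lerD//.
  rewrite (le_trans (expR_taylor2 _))//.
  rewrite [leRHS](_ : _ = t ^+ 2 * expR (2 * `|x|) * expR (1 + `|x|)); last first.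
    rewrite expRD (_ : 3 * `|x| = 2 * `|x| + `|x|) ?expRD; last by ring.
    by ring.
  by rewrite ler_pM ?sqr_ge0 ?expR_ge0// ler_expR addrC.
rewrite ger0_norm ?divr_ge0 ?sqr_ge0// ler_pM ?sqr_ge0//.
have := expR_ge1Dx (3 * `|x|); lra.
Qed.

Lemma integrable_normal_shift h L t : measurable_fun setT h ->
  (forall x, `|h x| <= L * expR `|x|) ->
  [/\ N.-integrable setT (EFin \o h),
      N.-integrable setT (EFin \o (fun x => h (x + t))) &
      N.-integrable setT (EFin \o (fun x => x * h x))].
Proof.
move=> mh hL.
have L0 : 0 <= L.
  by have := hL 0; rewrite normr0 expR0 mulr1; apply: le_trans.
have mt : measurable_fun [set: R] (fun x => x + t) by exact: measurable_funD.
split.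
- by apply: (@integrable_normal _ L 1) => // x; rewrite mul1r.
- apply: (@integrable_normal _ (L * expR `|t|) 1).
    exact: measurableT_comp.
  move=> x; rewrite (le_trans (hL _))// -mulrA ler_wpM2l// -expRD ler_expR.
  by rewrite mul1r addrC ler_normD.
- apply: (@integrable_normal _ L 2); first exact: measurable_funM.
  move=> x; rewrite normrM mulrC (_ : 2 * `|x| = `|x| + `|x|); last by ring.
  by rewrite expRD mulrA ler_pM// ler_norm_expR.
Qed.

(* By [normal_shift], h(x + t) - h(x) - t x h(x) has the mean of h times the
   second order remainder of exp(t x - t^2 / 2): h need not be differentiable. *)
Lemma normal_stein_expR : exists2 C, 0 <= C & forall h L t,
  measurable_fun setT h -> (forall x, `|h x| <= L * expR `|x|) -> `|t| <= 1 ->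
  `|EN (fun x => h (x + t) - h x - t * (x * h x))| <= L * C * t ^+ 2.
Proof.
(* The exponent 4 is 3 from [normal_shift_remainder] plus 1 from the growth allowed to h. *)
pose B (x : R) := (expR 1 + 1) * expR (4 * `|x|).
have iB : N.-integrable setT (EFin \o B).
  exact: integrableRZ (integrable_normal_expR 4).
exists (EN B).
  apply: Rintegral_ge0 => x _.
  by rewrite mulr_ge0 ?expR_ge0 ?addr_ge0 ?expR_ge0.
move=> h L t mh hL t1.
have L0 : 0 <= L.
  by have := hL 0; rewrite normr0 expR0 mulr1; apply: le_trans.
have hL1 x : `|h x| <= L * expR (1 * `|x|) by rewrite mul1r.
have mt : measurable_fun [set: R] (fun x => x + t) by exact: measurable_funD.
have mw : measurable_fun [set: R] (fun x => expR (t * x - t ^+ 2 / 2)).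
  by apply: measurableT_comp => //; apply: measurable_funB => //;
     exact: measurable_funM.
have [ih iht ihx] := integrable_normal_shift t mh hL.
have ihw : N.-integrable setT
    (EFin \o (fun x => h x * expR (t * x - t ^+ 2 / 2))).
  apply: (@integrable_normal _ L 2); first exact: measurable_funM.
  move=> x; rewrite normrM (_ : 2 * `|x| = `|x| + `|x|); last by ring.
  rewrite [expR (`|x| + _)]expRD mulrA ler_pM// ger0_norm ?expR_ge0// ler_expR.
  rewrite (@le_trans _ _ (`|t| * `|x|))//; last by rewrite ler_piMl.
  rewrite -normrM (le_trans _ (ler_norm _))// gerBl.
  by rewrite divr_ge0// sqr_ge0.
have -> : EN (fun x => h (x + t) - h x - t * (x * h x)) =
    EN (fun x => h x * (expR (t * x - t ^+ 2 / 2) - 1 - t * x)).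
  rewrite !RintegralTB//; [|exact: integrableRB|exact: integrableRZ].
  rewrite (normal_shift t mh ler01 hL1) -!RintegralTB//;
    [|exact: integrableRB|exact: integrableRZ].
  by apply: eq_RintegralT => x; ring.
rewrite [leRHS](_ : _ = EN (fun x => L * t ^+ 2 * B x)); last first.
  by rewrite RintegralTZ// mulrAC.
have e4 x : expR (4 * `|x|) = expR `|x| * expR (3 * `|x|).
  by rewrite -expRD; congr expR; ring.
have pw x : `|h x * (expR (t * x - t ^+ 2 / 2) - 1 - t * x)| <=
    (L * expR `|x|) * (t ^+ 2 * ((expR 1 + 1) * expR (3 * `|x|))).
  by rewrite normrM ler_pM//; exact: normal_shift_remainder.
apply: norm_RintegralT.
- apply: (@integrable_normal _ (L * (t ^+ 2 * (expR 1 + 1))) 4).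
    apply: measurable_funM => //; apply: measurable_funB => //.
    exact: measurable_funB.
  by move=> x; rewrite (le_trans (pw x))// e4 le_eqVlt; apply/orP; left; apply/eqP; ring.
- exact: integrableRZ.
- by move=> x; rewrite (le_trans (pw x))// /B e4 le_eqVlt; apply/orP; left; apply/eqP; ring.
Qed.

Lemma integrable_normal_id : N.-integrable setT (EFin \o (fun x : R => x)).
Proof.
apply: (@integrable_normal _ 1 1) => // x.
by rewrite !mul1r ler_norm_expR.
Qed.

Lemma integrable_normal_sqr : N.-integrable setT (EFin \o (fun x : R => x ^+ 2)).
Proof.
apply: (@integrable_normal _ 1 2); first exact: measurable_funX.
move=> x; rewrite mul1r expRM_natl normrX.
by rewrite lerXn2r ?nnegrE ?expR_ge0// ler_norm_expR.
Qed.

(** For h = 1 the expansion of [normal_stein_expR] reduces to |t E x| <= C t^2. *)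
Lemma normal_mean_eq0 : EN (fun x => x) = 0.
Proof.
have [C C0 HC] := normal_stein_expR.
apply: (@eq0_small_bound _ _ C) => t t0 t1.
have t1' : `|t| <= 1 by rewrite gtr0_norm.
have h1 x : `|cst 1 x| <= 1 * expR `|x|.
  by rewrite mul1r normr1 (le_trans _ (expR_ge1Dx _))// lerDl.
have := HC (cst 1) 1 t (measurable_cst _) h1 t1'.
have -> : EN (fun x => cst 1 (x + t) - cst 1 x - t * (x * cst 1 x)) =
    EN (fun x => (- t) * x).
  by apply: eq_RintegralT => x /=; ring.
rewrite RintegralTZ; last exact: integrable_normal_id.
rewrite normrM normrN (gtr0_norm t0).
by rewrite mul1r expr2 mulrA [C * t * t]mulrC ler_pM2l.
Qed.

(** For h the identity the expansion of [normal_stein_expR] reduces to |t (1 - E x^2)| <= C t^2. *)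
Lemma normal_var_eq1 : EN (fun x => x ^+ 2) = 1.
Proof.
have [C C0 HC] := normal_stein_expR.
apply/eqP; rewrite eq_sym -subr_eq0; apply/eqP.
apply: (@eq0_small_bound _ _ C) => t t0 t1.
have t1' : `|t| <= 1 by rewrite gtr0_norm.
have h1 x : `|x| <= 1 * expR `|x| by rewrite mul1r ler_norm_expR.
have := HC id 1 t (@measurable_id _ _ _) h1 t1'.
have -> : EN (fun x => id (x + t) - id x - t * (x * id x)) =
    EN (fun x => t * 1 - t * x ^+ 2).
  by apply: eq_RintegralT => x /=; ring.
rewrite RintegralTB; last 2 first.
- exact: integrableR_cst.
- exact/integrableRZ/integrable_normal_sqr.
rewrite (RintegralTZ t integrable_normal_sqr) RintegralT_cst mulr1.
rewrite -[X in X - _]mulr1 -mulrBr normrM (gtr0_norm t0).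
by rewrite mul1r expr2 mulrA [C * t * t]mulrC ler_pM2l.
Qed.

(** Subtracting h(0) changes the integrand by a multiple of x, which has mean zero, and leaves a
    function bounded by L exp |x|. The error therefore depends on h only through L, which makes it
    uniform over the fibres in [stein_move_snd]. *)
Lemma normal_stein : exists2 C, 0 <= C & forall h L t,
  measurable_fun setT h -> (forall x y, `|h x - h y| <= L * `|x - y|) ->
  `|EN (fun x => h (x + t) - h x - t * (x * h x))| <= L * C * t ^+ 2.
Proof.
have [C C0 HC] := normal_stein_expR; exists (C + 2); first by rewrite addr_ge0.
move=> h L t mh hL.
have L0 : 0 <= L.
  by have := hL 1 0; rewrite subr0 normr1 mulr1; apply: le_trans.
pose g x := h x - h 0.
have mg : measurable_fun setT g by exact: measurable_funB.
have gL x : `|g x| <= L * `|x| by rewrite (le_trans (hL _ _))// subr0.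
have ge x : `|g x| <= L * expR `|x|.
  by rewrite (le_trans (gL _))// ler_wpM2l// ler_norm_expR.
have [ig igt igx] := integrable_normal_shift t mg ge.
have igg : N.-integrable setT
    (EFin \o (fun x => g (x + t) - g x - t * (x * g x))).
  by apply: integrableRB; [exact: integrableRB|exact: integrableRZ].
have -> : EN (fun x => h (x + t) - h x - t * (x * h x)) =
    EN (fun x => g (x + t) - g x - t * (x * g x)).
  transitivity (EN (fun x => (g (x + t) - g x - t * (x * g x))
                             - (t * h 0) * x)).
    by apply: eq_RintegralT => x; rewrite /g; ring.
  rewrite RintegralTB//; last exact/integrableRZ/integrable_normal_id.
  rewrite RintegralTZ; last exact: integrable_normal_id.
  by rewrite normal_mean_eq0 mulr0 subr0.
have [t1|t1] := leP `|t| 1.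
  rewrite (le_trans (HC _ _ _ mg ge t1))// ler_wpM2r ?sqr_ge0//.
  by rewrite ler_wpM2l// lerDl.
have iS := integrable_normal_sqr.
apply: (@le_trans _ _ (EN (fun x => L * `|t| * 1 + L * `|t| * x ^+ 2))).
  apply: norm_RintegralT => //.
    by apply: integrableRD; [exact: integrableR_cst|exact: integrableRZ].
  move=> x; rewrite (le_trans (ler_normB _ _))// mulr1 lerD//.
    rewrite [X in `|X|](_ : _ = h (x + t) - h x); last by rewrite /g; ring.
    by rewrite (le_trans (hL _ _))// addrC addKr.
  rewrite !normrM (_ : x ^+ 2 = `|x| * `|x|); last by rewrite -expr2 real_normK ?num_real.
  rewrite [leRHS](_ : _ = `|t| * (`|x| * (L * `|x|))); last by ring.
  by rewrite !ler_wpM2l.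
rewrite RintegralTD; [|exact: integrableR_cst|exact: integrableRZ].
rewrite (RintegralTZ _ iS) RintegralT_cst normal_var_eq1 !mulr1.
have : `|t| <= t ^+ 2 by rewrite -[t ^+ 2]real_normK ?num_real//; nra.
move=> tt; rewrite -mulrA [leLHS](_ : _ = L * (`|t| * 2)); last by ring.
rewrite ler_wpM2l//.
have := sqr_ge0 t; nra.
Qed.

End normal_stein.

(** * Measurability of Lipschitz functions on tuples *)

Section tuple_measurability.
Context {R : realType}.

(* g is the infimum of the countably many cones f q with rational apex. *)
Lemma lipschitz_measurable k (g : k.-tuple R -> R) (L : R) :
  (forall x y, `|g x - g y| <= L * \sum_(i < k) `|tnth x i - tnth y i|) ->
  measurable_fun setT g.
Proof.
move=> gL.
have L1 x y : `|g x - g y| <= (`|L| + 1) * \sum_(i < k) `|tnth x i - tnth y i|.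
  rewrite (le_trans (gL _ _))// ler_wpM2r ?sumr_ge0//.
  by have := ler_norm L; lra.
set K := `|L| + 1 in L1; have K0 : 0 < K by rewrite ltr_wpDl.
pose rt (q : k.-tuple rat) : k.-tuple R := [tuple ratr (tnth q i) | i < k].
pose f q x := g (rt q) + K * \sum_(i < k) `|tnth x i - tnth (rt q) i|.
have mf q : measurable_fun setT (f q).
  apply: measurable_funD => //; apply: measurable_funM => //.
  apply: measurable_sum => i; apply: measurableT_comp => //.
  by apply: measurable_funB => //; exact: measurable_tnth.
have fg q x : g x <= f q x.
  by have := L1 x (rt q); rewrite ler_norml => /andP[_]; rewrite lerBlDl.
have approx x e : 0 < e -> exists q, f q x < g x + e.
  (* A rational apex within d of x in each coordinate costs K k d < e / 2 in the value of g and as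
     much again in the cone. [k.+1] keeps the quotient meaningful for k = 0 and makes the inequality
     strict. *)
  move=> e0; pose d := e / (2 * K * k.+1%:R).
  have d0 : 0 < d by rewrite divr_gt0// !mulr_gt0.
  have /choice[q qd] : forall i : 'I_k, exists q : rat, `|tnth x i - ratr q| < d.
    move=> i; have [|q] := @rat_in_itvoo R (tnth x i - d) (tnth x i + d).
      by rewrite ltrD2l gtrN.
    by rewrite in_itv/= => /andP[q1 q2]; exists q; rewrite distrC ltr_distl q1 q2.
  exists [tuple q i | i < k].
  have S : \sum_(i < k) `|tnth x i - tnth (rt [tuple q i | i < k]) i| <= d *+ k.
    rewrite -[in leRHS](card_ord k) -sumr_const ler_sum// => i _.
    by rewrite !tnth_mktuple ltW.
  have := L1 x (rt [tuple q i | i < k]); have := ler_wpM2l (ltW K0) S.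
  rewrite /f; set S1 := K * \sum_(i < k) _ => S2 L2.
  have : K * (d *+ k) < e / 2.
    rewrite -mulr_natr (_ : K * _ = e / 2 * (k%:R / k.+1%:R)); last first.
      by rewrite /d; field; rewrite !gt_eqF.
    by rewrite gtr_pMr ?divr_gt0// ltr_pdivrMr// mul1r ltr_nat.
  by move: L2; rewrite ler_norml => /andP[]; lra.
move=> mT; apply: (measurability _ (RGenInftyO.measurableE R)) => //.
move=> _ [_ [c ->] <-]; rewrite setTI.
rewrite (_ : _ @^-1` _ = \bigcup_q (f q @^-1` `]-oo, c[%classic)).
  apply: countable_bigcupT_measurable => // q.
  by rewrite -[X in measurable X]setTI; exact: mf.
apply/seteqP; split => [x /=|x [q _] /=]; rewrite !in_itv/= => xc.
  have [|q] := approx x (c - g x); first by rewrite subr_gt0.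
  by rewrite addrC subrK => fc; exists q => //=; rewrite in_itv.
exact: le_lt_trans xc.
Qed.

End tuple_measurability.

(** * Invariance of the joint law *)

Section image_measure.
Context d1 d2 (T1 : measurableType d1) (T2 : measurableType d2) (R : realType).
Variables (mu : {measure set T1 -> \bar R}) (f : T1 -> T2).
Hypothesis mf : measurable_fun setT f.

Definition image_measure : {measure set T2 -> \bar R}.
Proof. unshelve refine (pushforward mu f : {measure set T2 -> \bar R}); exact: mf. Defined.

Lemma image_measureE A : image_measure A = mu (f @^-1` A).
Proof. by []. Qed.

End image_measure.

Section boxes.
Context {R : realType} (k : nat).
Implicit Types (B : 'I_k -> set R) (z : k.-tuple R).

Definition box B : set (k.-tuple R) := [set z | forall i, B i (tnth z i)].

Definition boxes : set (set (k.-tuple R)) :=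
  [set A | exists2 B, (forall i, measurable (B i)) & A = box B].

Lemma measurable_box B : (forall i, measurable (B i)) -> measurable (box B).
Proof.
move=> mB; rewrite (_ : box B = \bigcap_i ((tnth (T:=R))^~ i @^-1` B i)).
  apply: fin_bigcap_measurable => // i _.
  by rewrite -[X in measurable X]setTI; exact: measurable_tnth.
by apply/seteqP; split => z /= H i; [move=> _|]; exact: H.
Qed.

Lemma boxT : box (fun=> setT) = setT.
Proof. by apply/seteqP; split. Qed.

Lemma measurable_tuple_boxes :
  @measurable _ (k.-tuple R) = <<s boxes >>.
Proof.
apply/seteqP; split; last first.
  apply: smallest_sub; first exact: sigma_algebra_measurable.
  by move=> _ [B mB ->]; exact: measurable_box.
apply: smallest_sub; first exact: smallest_sigma_algebra.
rewrite -bigcup_seq => _ [i _ [C mC <-]]; apply: sub_sigma_algebra.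
exists (fun j => if j == i then C else setT).
  by move=> j; case: ifP.
apply/seteqP; split => z /=.
  by move=> [_ Cz] j; case: eqP => // ->.
by move=> /(_ i); rewrite eqxx.
Qed.

(** Boxes generate the sigma-algebra, are stable under intersection and include the whole space, so
    finite measures agreeing on them are equal. *)
Lemma box_measure_unique (m1 m2 : {measure set (k.-tuple R) -> \bar R}) :
  (forall B, (forall i, measurable (B i)) -> m1 (box B) = m2 (box B)) ->
  (m1 setT < +oo)%E -> forall A, measurable A -> m1 A = m2 A.
Proof.
move=> m12 m1oo A mA.
apply: (measure_unique boxes (fun=> setT) measurable_tuple_boxes) => //.
- move=> _ _ [B mB ->] [C mC ->]; exists (fun i => B i `&` C i).
    by move=> i; exact: measurableI.
  apply/seteqP; split => [z [zB zC] i|z zBC].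
    by split; [exact: zB|exact: zC].
  by split => i; case: (zBC i).
- by exists (fun=> setT); rewrite ?boxT.
- by apply/seteqP; split => // z _; exists 0%N.
- by move=> _ [B mB ->]; exact: m12.
Qed.

Definition tset (z : k.-tuple R) i (v : R) : k.-tuple R :=
  [tuple if j == i then v else tnth z j | j < k].

(** Overwriting coordinate i frees it in z and transfers its constraint to v, so preimages of boxes
    remain rectangles. *)
Lemma tset_box B i :
  (fun zx => tset zx.1 i zx.2) @^-1` box B =
  box (fun j => if j == i then setT else B j) `*` B i.
Proof.
apply/seteqP; split => [[z v] /= H|[z v] [/= H Bv] j].
  split => [j|]; last by have := H i; rewrite tnth_mktuple eqxx.
  by have := H j; rewrite tnth_mktuple; case: eqP.
rewrite tnth_mktuple; case: eqP => [->//|/eqP ji].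
by have := H j; rewrite (negbTE ji).
Qed.

Lemma measurable_tset i :
  measurable_fun [set: k.-tuple R * measurableTypeR R]
    (fun zx => tset zx.1 i (zx.2 : R)).
Proof.
apply/measurable_fun_tnthP => j.
rewrite (_ : _ \o _ = (fun zx : k.-tuple R * measurableTypeR R =>
  if j == i then zx.2 else tnth zx.1 j)); last first.
  by apply/funext => -[z v] /=; rewrite tnth_mktuple.
case: (j == i); first exact: (@measurable_snd _ _ _ (measurableTypeR R)).
by apply: (measurableT_comp (measurable_tnth j)).
Qed.

End boxes.

Section gaussian_resampling.
Context {R : realType} (n k : nat).
Variables (mu : probability (n.-tuple R) R) (nu : probability (k.-tuple R) R).
Local Notation N := (@normal_prob R 0 1).
Hypothesis nu_coord : forall (i : 'I_k) (A : set R), measurable A ->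
  nu [set z | A (tnth z i)] = N A.
Hypothesis nu_box : forall A : 'I_k -> set R, (forall i, measurable (A i)) ->
  nu (box A) = (\prod_(i < k) nu [set z | A i (tnth z i)])%E.

Definition resample (i : 'I_k)
    (q : (n.-tuple R * k.-tuple R) * measurableTypeR R) :=
  (q.1.1, tset q.1.2 i q.2).

Lemma measurable_resample i : measurable_fun setT (resample i).
Proof.
apply: measurable_fun_pair; first exact: measurableT_comp.
pose f (q : (n.-tuple R * k.-tuple R) * measurableTypeR R) := (q.1.2, q.2).
have mf : measurable_fun setT f.
  by apply: measurable_fun_pair => //; exact: measurableT_comp.
exact: (measurableT_comp (measurable_tset i) mf).
Qed.

Lemma nu_box_resample (B : 'I_k -> set R) i : (forall i, measurable (B i)) ->
  nu (box B) = (nu (box (fun j => if j == i then setT else B j)) * N (B i))%E.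
Proof.
move=> mB; have mB' j : measurable (if j == i then setT else B j) by case: ifP.
rewrite !nu_box// (bigD1 i)//= [in RHS](bigD1 i)//= eqxx.
rewrite !nu_coord// (_ : N setT = 1%E) ?mul1e; last exact: probability_setT.
rewrite muleC; congr (_ * _)%E; apply: eq_bigr => j ji.
by rewrite (negbTE ji).
Qed.

(* The independence of Y and Z and the law of Z are only used in this form. *)
Lemma resample_invariant i (A : set (n.-tuple R * k.-tuple R)) :
  measurable A ->
  (mu \x nu)%E A = ((mu \x nu) \x N)%E (resample i @^-1` A).
Proof.
rewrite -(image_measureE ((mu \x nu) \x N)%E (@measurable_resample i)).
apply: product_measure_unique => {A} C D mC mD; rewrite image_measureE.
have mCT : measurable (C `*` [set: k.-tuple R]) by exact: measurableX.
have mCTT : measurable ((C `*` [set: k.-tuple R]) `*` [set: measurableTypeR R]).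
  exact: measurableX.
have ms := measurableT_comp measurable_snd (@measurable_resample i).
(* After the reduction to rectangles C x D, the set C is fixed and both sides become finite measures
   in D, [m1] without and [m2] with resampling. It then suffices to compare them on boxes, where
   [nu_box_resample] applies. *)
pose m2 := image_measure (mrestr ((mu \x nu) \x N)%E mCTT) ms.
pose m1 := image_measure (mrestr (mu \x nu)%E mCT) measurable_snd.
transitivity (m2 D).
  rewrite /m2 image_measureE /mrestr; congr ((_ \x _)%E _).
  by apply/seteqP; split => [[[y z] x] []|[[y z] x] [? [[]]]].
transitivity (m1 D); last first.
  rewrite /m1 image_measureE /mrestr -product_measure1E//.
  congr ((_ \x _)%E _).
  by apply/seteqP; split => [[y z] [? []]|[y z] []].
apply/esym/box_measure_unique => //.
  move=> B mB; pose B' j := if j == i then setT else B j.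
  have mB' : measurable (box B') by apply: measurable_box => j; rewrite /B'; case: ifP.
  rewrite /m1 /m2 !image_measureE /mrestr.
  transitivity ((mu \x nu)%E (C `*` box B)).
    congr ((_ \x _)%E _).
    by apply/seteqP; split => [[y z] /= [? []]|[y z] /= []].
  transitivity (((mu \x nu) \x N)%E ((C `*` box B') `*` B i)); last first.
    congr ((_ \x _)%E _).
    apply/seteqP; split => [[[y z] x] [[/= Cy zB'] xB]|[[y z] x] [+ [[/= Cy _] _]]].
      split=> //; have : ((fun zx => tset zx.1 i zx.2) @^-1` box B) (z, x).
        by rewrite tset_box.
      by [].
    move=> H; have : ((fun zx => tset zx.1 i zx.2) @^-1` box B) (z, x) by exact: H.
    by rewrite tset_box => -[].
  have mBB := measurable_box mB.
  have e1 := product_measure1E mu nu mC mB'.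
  have e2 := product_measure1E mu nu mC mBB.
  have e3 := product_measure1E (mu \x nu)%E N (measurableX mC mB') (mB i).
  rewrite e2 e3; transitivity (mu C * nu (box B') * N (B i))%E.
    by rewrite -muleA -nu_box_resample.
  by congr (_ * _)%E; exact: (esym e1).
have mP : measurable (snd @^-1` [set: k.-tuple R] `&` C `*` [set: k.-tuple R]).
  by rewrite preimage_setT setTI.
exact: (le_lt_trans (@probability_le1 _ _ _ (mu \x nu)%E _ mP) (ltry _)).
Qed.

End gaussian_resampling.

Section gaussian_resampling_integral.
Context {R : realType} (n k : nat).
Variable pi : probability (n.-tuple R * k.-tuple R)%type R.
Local Notation N := (@normal_prob R 0 1).
Variable i : 'I_k.
Hypothesis inv : forall A, measurable A ->
  pi A = (pi \x N)%E (resample i @^-1` A).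
Implicit Types f : n.-tuple R * k.-tuple R -> R.

Lemma ge0_integral_resample f : measurable_fun setT f ->
  (forall p, 0 <= f p) ->
  (\int[pi]_p (f p)%:E = \int[pi]_p \int[N]_x (f (resample i (p, x)))%:E)%E.
Proof.
move=> mf f0.
have mr := @measurable_resample R n k i.
have mEf : measurable_fun setT (EFin \o f) by exact/measurable_EFinP.
transitivity (\int[pushforward (pi \x N)%E (resample i)]_p (f p)%:E)%E.
  by apply: eq_measure_integral => A mA _; exact: inv.
rewrite ge0_integral_pushforward// ?preimage_setT; last by move=> p _; rewrite lee_fin.
rewrite fubini_tonelli1//.
- exact: measurableT_comp mEf mr.
- by move=> q; rewrite lee_fin.
Qed.

(** Invariance moves the integral to the product with [N], and Fubini integrates the fresh
    coordinate first. Integrability is asked on every fibre, so the real-valued inner integral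
    agrees everywhere with the extended one of Fubini. *)
Lemma integral_resample f h : pi.-integrable setT (EFin \o f) ->
  (forall p, N.-integrable setT (EFin \o (fun x => f (resample i (p, x))))) ->
  (forall p, \int[N]_x f (resample i (p, x)) = h p) ->
  pi.-integrable setT (EFin \o h) /\ \int[pi]_p f p = \int[pi]_p h p.
Proof.
move=> fi fNi fh.
have mr := @measurable_resample R n k i.
have /integrableP[mEf _] := fi.
pose F q := (f (resample i q))%:E.
have iF : (pi \x N)%E.-integrable setT F.
  have mF : measurable_fun setT F := measurableT_comp mEf mr.
  apply/integrableP; split => //.
  rewrite fubini_tonelli1//=; last first.
    exact: (measurableT_comp (@abse_measurable R setT) mF).
  rewrite -(@ge0_integral_resample (fun p => `|f p|))//.
    by case/integrableP : fi.
  by apply: measurableT_comp => //; exact/measurable_EFinP.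
have hE p : (EFin \o h) p = fubini_F N F p.
  rewrite /= -fh /Rintegral fineK//.
  exact: (integrable_fin_num measurableT (fNi p)).
have -> : EFin \o h = fubini_F N F by apply/funext.
split; first exact: integrable_fubini_F.
rewrite /Rintegral; congr fine.
transitivity (\int[pushforward (pi \x N)%E (resample i)]_p (f p)%:E)%E.
  by apply: eq_measure_integral => A mA _; exact: inv.
rewrite integral_pushforward// preimage_setT -integral12_prod_meas1//.
by apply: eq_integral => p _; exact: (esym (hE p)).
Qed.

End gaussian_resampling_integral.

Section plane_rotation.
Context {R : realType} (n : nat).
Variables (i j : 'I_n) (c s : R).
Hypotheses (ij : i != j) (cs : c ^+ 2 + s ^+ 2 = 1).

Definition plane_rot (y : n.-tuple R) : n.-tuple R :=
  [tuple if l == i then c * tnth y i + s * tnth y j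
         else if l == j then c * tnth y j - s * tnth y i else tnth y l | l < n].

Definition plane_rot_mx : 'M[R]_n := \matrix_(a, b)
  (if a == i then c * (b == i)%:R + s * (b == j)%:R
   else if a == j then c * (b == j)%:R - s * (b == i)%:R else (b == a)%:R).

Lemma sum_delta_mulr (a : 'I_n) (f : 'I_n -> R) :
  \sum_l (l == a)%:R * f l = f a.
Proof.
rewrite (bigD1 a)//= eqxx mul1r big1 ?addr0// => l /negbTE ->.
by rewrite mul0r.
Qed.

(** With [f] arbitrary this serves both for the action on vectors and for the scalar products of
    rows in the orthogonality proof. *)
Lemma sum_plane_rot_mx a (f : 'I_n -> R) :
  \sum_l plane_rot_mx a l * f l =
  if a == i then c * f i + s * f j
  else if a == j then c * f j - s * f i else f a.
Proof.
under eq_bigr do rewrite mxE.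
case: ifP => _.
  under eq_bigr do rewrite mulrDl -!mulrA.
  by rewrite big_split/= -!mulr_sumr !sum_delta_mulr.
case: ifP => _; last by rewrite sum_delta_mulr.
under eq_bigr do rewrite mulrBl -!mulrA.
by rewrite sumrB/= -!mulr_sumr !sum_delta_mulr.
Qed.

Lemma mxact_plane_rot : mxact plane_rot_mx =1 plane_rot.
Proof.
move=> y; apply/eq_from_tnth => a; rewrite !tnth_mktuple mxE -sum_plane_rot_mx.
by apply: eq_bigr => l _; rewrite !mxE.
Qed.

Lemma orthogonal_plane_rot_mx : orthogonal_mx plane_rot_mx.
Proof.
apply/matrixP => a b; rewrite !mxE.
under eq_bigr do rewrite [X in _ * X]mxE.
(* The entry (a, b) of U U^T is row a applied to row b. After the split on which indices equal i or
   j, only the diagonal entries at i and j use c^2 + s^2 = 1. *)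
rewrite sum_plane_rot_mx !mxE.
have ji : (j == i) = false by rewrite eq_sym (negbTE ij).
have [ai|ai] := eqVneq a i; have [bi|bi] := eqVneq b i;
  have [aj|aj] := eqVneq a j; have [bj|bj] := eqVneq b j;
  try by move: ij; rewrite -?ai -?aj -?bi -?bj ?ai ?aj ?bi ?bj eqxx.
all: rewrite ?ai ?aj ?bi ?bj ?eqxx ?ji ?(negbTE ij) ?(negbTE ai) ?(negbTE bi)
  ?(negbTE aj) ?(negbTE bj) ?(eq_sym i b) ?(eq_sym j b) ?(negbTE bi)
  ?(negbTE bj) ?[i == a]eq_sym ?[j == a]eq_sym ?(negbTE ai) ?(negbTE aj) /=.
all: try ring.
all: by transitivity (c ^+ 2 + s ^+ 2); [ring|rewrite cs].
Qed.

Lemma measurable_plane_rot : measurable_fun setT plane_rot.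
Proof.
apply/measurable_fun_tnthP => l.
rewrite (_ : _ \o _ = (fun y => if l == i then c * tnth y i + s * tnth y j
  else if l == j then c * tnth y j - s * tnth y i else tnth y l)); last first.
  by apply/funext => y /=; rewrite tnth_mktuple.
have mt a : measurable_fun [set: n.-tuple R] ((tnth (T:=R))^~ a).
  exact: measurable_tnth.
case: (l == i); first by apply: measurable_funD; exact: measurable_funM.
by case: (l == j) => //; apply: measurable_funB; exact: measurable_funM.
Qed.

Variables (k : nat).
Variables (mu : probability (n.-tuple R) R) (nu : probability (k.-tuple R) R).
Hypothesis mu_rot : forall U : 'M[R]_n, orthogonal_mx U ->
  forall A, measurable A -> mu (mxact U @^-1` A) = mu A.

Lemma plane_rot_invariant (A : set (n.-tuple R * k.-tuple R)) :
  measurable A ->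
  (mu \x nu)%E A = (mu \x nu)%E ((fun p => (plane_rot p.1, p.2)) @^-1` A).
Proof.
have mr : measurable_fun [set: n.-tuple R * k.-tuple R]
    (fun p => (plane_rot p.1, p.2)).
  apply: measurable_fun_pair => //.
  exact: (measurableT_comp measurable_plane_rot).
rewrite -(image_measureE (mu \x nu)%E mr).
apply: product_measure_unique => {A} C D mC mD; rewrite image_measureE.
have mC' : measurable (plane_rot @^-1` C).
  by rewrite -[X in measurable X]setTI; exact: measurable_plane_rot.
transitivity (mu (plane_rot @^-1` C) * nu D)%E.
  exact: (product_measure1E mu nu mC' mD).
congr (_ * _)%E; transitivity (mu (mxact plane_rot_mx @^-1` C)).
  congr (mu _).
  by apply/seteqP; split => y /=; rewrite mxact_plane_rot.
exact: mu_rot orthogonal_plane_rot_mx _ mC.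
Qed.

End plane_rotation.

(** * Functions of polynomial growth *)

Section tame.
Context {R : realType} (n k : nat).
Local Notation Om := (n.-tuple R * k.-tuple R)%type.
Implicit Types (f g : Om -> R) (p : Om).

Definition size1 p : R :=
  1 + \sum_(i < n) `|tnth p.1 i| + \sum_(i < k) `|tnth p.2 i|.

Lemma size1_ge1 p : 1 <= size1 p.
Proof. by rewrite /size1 -addrA lerDl addr_ge0// sumr_ge0. Qed.

Lemma size1_ge0 p : 0 <= size1 p.
Proof. exact: le_trans (size1_ge1 p). Qed.

Lemma measurable_fst_tnth i : measurable_fun [set: Om] (fun p => tnth p.1 i).
Proof. exact: (measurableT_comp (measurable_tnth i) measurable_fst). Qed.

Lemma measurable_snd_tnth i : measurable_fun [set: Om] (fun p => tnth p.2 i).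
Proof. exact: (measurableT_comp (measurable_tnth i) measurable_snd). Qed.

(** Degree bookkeeping: degrees add under products, and since [size1] is at least 1 a lower degree
    can be raised. Degree 4 is the last one that the available moments make integrable. *)
Definition tame m f := measurable_fun setT f /\
  exists C, forall p, `|f p| <= C * size1 p ^+ m.

Lemma tame_le m m' f : (m <= m')%N -> tame m f -> tame m' f.
Proof.
move=> mm' [mf [C fC]]; split=> //; exists `|C| => p.
rewrite (le_trans (fC p))// (@le_trans _ _ (`|C| * size1 p ^+ m))//.
  by rewrite ler_wpM2r ?exprn_ge0 ?size1_ge0// ler_norm.
by rewrite ler_wpM2l// ler_weXn2l// size1_ge1.
Qed.

Lemma tame_cst m c : tame m (cst c).
Proof.
split=> //; exists `|c| => p; rewrite ler_peMr//.
by rewrite exprn_ege1// size1_ge1.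
Qed.

Lemma tame_fst i : tame 1 (fun p => tnth p.1 i).
Proof.
split; first exact: measurable_fst_tnth.
exists 1 => p; rewrite mul1r expr1 /size1 (bigD1 i)//=.
have := @sumr_ge0 R _ (index_enum 'I_n) (fun l => l != i) (fun l => `|tnth p.1 l|) (fun l _ => normr_ge0 _).
have := @sumr_ge0 R _ (index_enum 'I_k) xpredT (fun l => `|tnth p.2 l|) (fun l _ => normr_ge0 _).
lra.
Qed.

Lemma tame_snd i : tame 1 (fun p => tnth p.2 i).
Proof.
split; first exact: measurable_snd_tnth.
exists 1 => p; rewrite mul1r expr1 /size1 [X in _ <= _ + X](bigD1 i)//=.
have := @sumr_ge0 R _ (index_enum 'I_k) (fun l => l != i) (fun l => `|tnth p.2 l|) (fun l _ => normr_ge0 _).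
have := @sumr_ge0 R _ (index_enum 'I_n) xpredT (fun l => `|tnth p.1 l|) (fun l _ => normr_ge0 _).
lra.
Qed.

Lemma tameD m f g : tame m f -> tame m g -> tame m (fun p => f p + g p).
Proof.
move=> [mf [C fC]] [mg [C' gC]]; split; first exact: measurable_funD.
exists (C + C') => p; rewrite mulrDl (le_trans (ler_normD _ _))//.
by rewrite lerD.
Qed.

Lemma tameM m m' f g : tame m f -> tame m' g -> tame (m + m') (fun p => f p * g p).
Proof.
move=> [mf [C fC]] [mg [C' gC]]; split; first exact: measurable_funM.
by exists (C * C') => p; rewrite exprD mulrACA normrM ler_pM.
Qed.

Lemma tameN m f : tame m f -> tame m (fun p => - f p).
Proof.
move=> [mf [C fC]]; split; first exact: measurableT_comp.
by exists C => p; rewrite normrN.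
Qed.

Lemma tameB m f g : tame m f -> tame m g -> tame m (fun p => f p - g p).
Proof. by move=> tf tg; apply: tameD => //; exact: tameN. Qed.

Lemma tameZ m c f : tame m f -> tame m (fun p => c * f p).
Proof. by move=> tf; exact: (tameM (tame_cst 0 c) tf). Qed.

Lemma tame_norm m f : tame m f -> tame m (fun p => `|f p|).
Proof.
move=> [mf [C fC]]; split; first exact: measurableT_comp.
by exists C => p; rewrite normr_id.
Qed.

Lemma tameX m f e : tame m f -> tame (e * m) (fun p => f p ^+ e).
Proof.
move=> [mf [C fC]]; split; first exact: measurable_funX.
exists (C ^+ e) => p; rewrite normrX mulnC exprM -exprMn.
by rewrite lerXn2r ?nnegrE// (le_trans _ (fC p)).
Qed.

Lemma tame_sum m (I : Type) (r : seq I) (P : pred I) (f : I -> Om -> R) :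
  (forall i, tame m (f i)) -> tame m (fun p => \sum_(i <- r | P i) f i p).
Proof.
move=> tf; elim: r => [|i r IH].
  rewrite (_ : (fun _ => _) = cst 0); last by apply/funext => p; rewrite big_nil.
  exact: tame_cst.
rewrite (_ : (fun _ => _) = (fun p => (if P i then f i p else 0) +
    \sum_(i <- r | P i) f i p)); last first.
  by apply/funext => p; rewrite big_cons; case: ifP => // _; rewrite add0r.
apply: tameD => //; case: (P i) => //.
exact: tame_cst.
Qed.

End tame.

Section tame_integrable.
Context {R : realType} (n k : nat).
Local Notation Om := (n.-tuple R * k.-tuple R)%type.
Variable pi : probability Om R.
Local Notation N := (@normal_prob R 0 1).
Hypothesis pi_res : forall i A, measurable A ->
  pi A = (pi \x N)%E (resample i @^-1` A).
Hypothesis pi_fst4 : forall i,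
  pi.-integrable setT (EFin \o (fun p => tnth p.1 i ^+ 4)).

(** Resampling coordinate i leaves the fourth moment of [N], finite because x^4 <= exp(4 |x|). *)
Lemma pi_snd4 i : pi.-integrable setT (EFin \o (fun p : Om => tnth p.2 i ^+ 4)).
Proof.
have mz : measurable_fun setT (fun p : Om => tnth p.2 i ^+ 4).
  by apply: measurable_funX; exact: measurable_snd_tnth.
have x0 (x : R) : 0 <= x ^+ 4 by rewrite exprn_even_ge0.
apply/integrableP; split; first exact/measurable_EFinP.
under eq_integral do rewrite /= ger0_norm//.
rewrite (ge0_integral_resample (pi_res i))//.
under eq_integral do under eq_integral do rewrite /= tnth_mktuple eqxx.
rewrite integral_cst//= (_ : pi setT = 1%E) ?mule1; last exact: probability_setT.
have /integrableP[_] : N.-integrable setT (EFin \o (fun x : R => x ^+ 4)).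
  apply: (@integrable_normal _ _ 1 4); first exact: measurable_funX.
  move=> x; rewrite mul1r expRM_natl normrX.
  by rewrite lerXn2r ?nnegrE ?expR_ge0// ler_norm_expR.
apply: le_lt_trans; apply: ge0_le_integral => //.
- by move=> x _; rewrite lee_fin.
- exact/measurable_EFinP/measurable_funX.
- exact/measurableT_comp/measurable_EFinP/measurable_funX.
- by move=> x _; rewrite /= lee_fin ler_norm.
Qed.

Lemma pow4D (a b : R) : (a + b) ^+ 4 <= 8 * (a ^+ 4 + b ^+ 4).
Proof.
have h (x y : R) : (x + y) ^+ 2 <= 2 * (x ^+ 2 + y ^+ 2).
  by have := sqr_ge0 (x - y); rewrite !expr2; lra.
have := h a b; have := h (a ^+ 2) (b ^+ 2); rewrite -!exprM /= => h1 h2.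
have h0 : 0 <= (a + b) ^+ 2 by exact: sqr_ge0.
rewrite [leLHS](_ : _ = ((a + b) ^+ 2) ^+ 2); last by rewrite -exprM.
have : ((a + b) ^+ 2) ^+ 2 <= (2 * (a ^+ 2 + b ^+ 2)) ^+ 2.
  by rewrite lerXn2r ?nnegrE// (le_trans h0).
rewrite exprMn; lra.
Qed.

Lemma integrable_pow4D (f g : Om -> R) :
  measurable_fun setT f -> measurable_fun setT g ->
  pi.-integrable setT (EFin \o (fun p => f p ^+ 4)) ->
  pi.-integrable setT (EFin \o (fun p => g p ^+ 4)) ->
  pi.-integrable setT (EFin \o (fun p => (f p + g p) ^+ 4)).
Proof.
move=> mf mg fi gi.
apply: (@le_integrableR _ _ _ _ _ (fun p => 8 * (f p ^+ 4 + g p ^+ 4))).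
- by apply: measurable_funX; exact: measurable_funD.
- by move=> p; rewrite ger0_norm ?exprn_even_ge0// pow4D.
- by apply: integrableRZ; exact: integrableRD.
Qed.

Lemma integrable_pow4_sum (I : Type) (r : seq I) (f : I -> Om -> R) :
  (forall i, measurable_fun setT (f i)) ->
  (forall i, pi.-integrable setT (EFin \o (fun p => f i p ^+ 4))) ->
  pi.-integrable setT (EFin \o (fun p => (\sum_(i <- r) f i p) ^+ 4)).
Proof.
move=> mf fi; elim: r => [|i r IH].
  rewrite (_ : (fun _ => _) = cst 0); first exact: integrableR_cst.
  by apply/funext => p; rewrite big_nil expr0n.
rewrite (_ : (fun _ => _) = (fun p => (f i p + \sum_(i <- r) f i p) ^+ 4)).
  by apply: integrable_pow4D => //; exact: measurable_sum.
by apply/funext => p; rewrite big_cons.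
Qed.

Lemma integrable_size1 : pi.-integrable setT (EFin \o (fun p => size1 p ^+ 4)).
Proof.
have n4 (x : R) : `|x| ^+ 4 = x ^+ 4.
  by rewrite -normrX ger0_norm ?exprn_even_ge0.
have m1 (i : 'I_n) : measurable_fun [set: Om] (fun p => `|tnth p.1 i|).
  by apply: measurableT_comp => //; exact: measurable_fst_tnth.
have m2 (i : 'I_k) : measurable_fun [set: Om] (fun p => `|tnth p.2 i|).
  by apply: measurableT_comp => //; exact: measurable_snd_tnth.
apply: integrable_pow4D.
- by apply: measurable_funD => //; exact: measurable_sum.
- exact: measurable_sum.
- apply: integrable_pow4D => //; first exact: measurable_sum.
    exact: integrableR_cst.
  by apply: integrable_pow4_sum => // i; under eq_fun do rewrite n4.
- by apply: integrable_pow4_sum => // i; under eq_fun do rewrite n4; exact: pi_snd4.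
Qed.

Lemma integrable_tame m (f : Om -> R) : tame m f -> (m <= 4)%N ->
  pi.-integrable setT (EFin \o f).
Proof.
move=> tf m4; have [mf [C fC]] := tame_le m4 tf.
apply: (le_integrableR mf fC).
by apply: integrableRZ; exact: integrable_size1.
Qed.

End tame_integrable.

(** * Stein's identity on the joint space *)

Section affine.
Context {R : realType} (n k : nat).
Local Notation Om := (n.-tuple R * k.-tuple R)%type.
Implicit Types (X : 'I_k -> n.-tuple R -> R) (c s t : R) (p : Om) (i l : 'I_k).

(** A common form for the path [mix], where X_l is linear in y, and for the smoothing [blur], where
    X_l is constant: [stein_move_snd] serves both. *)
Definition affine X s p : k.-tuple R :=
  [tuple X l p.1 + s * tnth p.2 l | l < k].

Definition mix (kn : (k <= n)%N) c s : Om -> k.-tuple R :=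
  affine (fun l y => c * tnth y (widen_ord kn l)) s.

Lemma tame_affine X s l : tame 1 (fun p : Om => X l p.1) ->
  tame 1 (fun p => tnth (affine X s p) l).
Proof.
move=> tX; rewrite (_ : (fun _ => _) = (fun p => X l p.1 + s * tnth p.2 l)).
  by apply: tameD => //; apply: tameZ; exact: tame_snd.
by apply/funext => p; rewrite tnth_mktuple.
Qed.

Lemma tame_mix kn c s l : tame 1 (fun p => tnth (mix kn c s p) l).
Proof. by apply: tame_affine; apply: tameZ; exact: tame_fst. Qed.

Lemma measurable_mix kn c s : measurable_fun setT (mix kn c s).
Proof. by apply/measurable_fun_tnthP => l; case: (tame_mix kn c s l). Qed.

(** The Lipschitz bound against the origin gives |g(S)| <= |g(0)| + sum |S_l|. *)
Lemma tame_lipschitz g (S : Om -> k.-tuple R) :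
  (forall x y : k.-tuple R, `|g x - g y| <= \sum_l `|tnth x l - tnth y l|) ->
  (forall l, tame 1 (fun p => tnth (S p) l)) ->
  tame 1 (fun p => g (S p)).
Proof.
move=> gl tS; have mg : measurable_fun setT g.
  by apply: (@lipschitz_measurable _ _ _ 1) => x y; rewrite mul1r.
have mS : measurable_fun setT S.
  by apply/measurable_fun_tnthP => l; case: (tS l).
split; first exact: (measurableT_comp mg mS).
pose x0 : k.-tuple R := [tuple 0 | l < k].
have [_ [C HC]] : tame 1 (fun p : Om => `|g x0| + \sum_l `|tnth (S p) l|).
  by apply: tameD; [exact: tame_cst|apply: tame_sum => l; exact: tame_norm].
exists C => p; rewrite (le_trans _ (HC p))// (le_trans _ (ler_norm _))//.
rewrite -[g _](subrK (g x0)) (le_trans (ler_normD _ _))// addrC lerD2l.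
rewrite (le_trans (gl _ _))// le_eqVlt; apply/orP; left; apply/eqP.
by apply: eq_bigr => l _; rewrite [tnth x0 l]tnth_mktuple subr0.
Qed.

Lemma tset_id (z : k.-tuple R) i (v w : R) : tset (tset z i v) i w = tset z i w.
Proof.
by apply: eq_from_tnth => l; rewrite !tnth_mktuple; case: eqP.
Qed.

Lemma tnth_tset (z : k.-tuple R) i (v : R) : tnth (tset z i v) i = v.
Proof. by rewrite tnth_mktuple eqxx. Qed.

Definition move_snd i t p : Om := (p.1, tset p.2 i (tnth p.2 i + t)).

Lemma measurable_move_snd i t : measurable_fun setT (move_snd i t).
Proof.
pose f p : Om * measurableTypeR R := (p, tnth p.2 i + t).
have mf : measurable_fun setT f.
  apply: measurable_fun_pair => //.
  have m1 : measurable_fun [set: Om] (fun p => tnth p.2 i + t).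
    by apply: measurable_funD => //; exact: measurable_snd_tnth.
  exact m1.
exact: (measurableT_comp (@measurable_resample R n k i) mf).
Qed.

Lemma affine_move_snd X s i t p l :
  tnth (affine X s (move_snd i t p)) l =
  tnth (affine X s p) l + s * t * (l == i)%:R.
Proof.
rewrite !tnth_mktuple/= addrAC -addrA; congr (_ + _).
by case: eqP => [->|_] /=; ring.
Qed.

Lemma sum_delta_norm i t : \sum_(l < k) `|t * (l == i)%:R| = `|t|.
Proof.
rewrite (bigD1 i)//= eqxx mulr1 big1 ?addr0// => l /negbTE ->.
by rewrite mulr0 normr0.
Qed.

End affine.

Section stein.
Context {R : realType} (n k : nat).
Local Notation Om := (n.-tuple R * k.-tuple R)%type.
Variable pi : probability Om R.
Local Notation N := (@normal_prob R 0 1).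
Local Notation E f := (\int[pi]_p f p).
Hypothesis pi_res : forall i A, measurable A ->
  pi A = (pi \x N)%E (resample i @^-1` A).
Hypothesis pi_fst4 : forall i,
  pi.-integrable setT (EFin \o (fun p => tnth p.1 i ^+ 4)).

Section lipschitz.
Variables (g : k.-tuple R -> R) (X : 'I_k -> n.-tuple R -> R) (s : R).
Hypothesis g_lip : forall x y, `|g x - g y| <= \sum_l `|tnth x l - tnth y l|.
Hypothesis tX : forall l, tame 1 (fun p : Om => X l p.1).
Local Notation S := (affine X s).

Lemma lipschitz_move_snd i t p :
  `|g (S (move_snd i t p)) - g (S p)| <= `|s * t|.
Proof.
rewrite (le_trans (g_lip _ _))// -(sum_delta_norm i) ler_sum// => l _.
by rewrite affine_move_snd addrC addKr.
Qed.

Lemma tame_move_snd i t :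
  tame 0 (fun p => g (S (move_snd i t p)) - g (S p)).
Proof.
split; last by exists `|s * t| => p; rewrite mulr1 lipschitz_move_snd.
have [mgS _] := tame_lipschitz g_lip (fun l => tame_affine s (tX l)).
apply: measurable_funB => //.
exact: (measurableT_comp mgS (measurable_move_snd i t)).
Qed.

End lipschitz.

(** Once [z_i] is resampled as x, the other variables are frozen and the translation of [z_i] is a
    translation of x. The one-dimensional [normal_stein] then applies on each fibre, and its bound
    is integrated against |phi|. *)
Lemma stein_move_snd : exists2 C, 0 <= C &
  forall (g : k.-tuple R -> R) (X : 'I_k -> n.-tuple R -> R)
    (phi : n.-tuple R -> R) (i : 'I_k) (s t : R),
  (forall x y, `|g x - g y| <= \sum_l `|tnth x l - tnth y l|) ->
  (forall l, tame 1 (fun p : Om => X l p.1)) -> tame 1 (fun p : Om => phi p.1) ->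
  `|E (fun p => (g (affine X s (move_snd i t p)) - g (affine X s p)
     - t * (tnth p.2 i * g (affine X s p))) * phi p.1)| <=
  `|s| * C * t ^+ 2 * E (fun p => `|phi p.1|).
Proof.
have [C C0 HC] := @normal_stein R; exists C => //.
move=> g X phi i s t g_lip tX tphi.
have mg : measurable_fun setT g.
  by apply: (@lipschitz_measurable _ _ _ 1) => x y; rewrite mul1r.
have iy := integrable_tame pi_res pi_fst4 (tame_norm tphi) isT.
set f := fun p : Om => _.
have tS l := tame_affine s (tX l).
have tf : tame 3 f.
  rewrite -[3%N]/(2 + 1)%N; apply: tameM => //; apply: tameB.
    exact: (tame_le (leq0n _) (tame_move_snd s g_lip tX i t)).
  apply: tameZ; rewrite -[2%N]/(1 + 1)%N; apply: tameM; first exact: tame_snd.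
  exact: tame_lipschitz.
have jf := integrable_tame pi_res pi_fst4 tf isT.
(* The function seen on the fibre through p has Lipschitz constant |s| for every p, whence the
   factor |s| C. *)
pose h (p : Om) (x : R) := g (affine X s (p.1, tset p.2 i x)).
have hl p x y : `|h p x - h p y| <= `|s| * `|x - y|.
  rewrite (le_trans (g_lip _ _))// -normrM -(sum_delta_norm i) ler_sum// => l _.
  rewrite !tnth_mktuple/=; case: eqP => _; rewrite ?mulr1 ?mulr0.
    by rewrite [X in `|X| <= _](_ : _ = s * (x - y))//; ring.
  by rewrite subrr.
have mh p : measurable_fun setT (h p).
  have m1 : measurable_fun [set: measurableTypeR R] (fun x : R => (p, x)).
    by apply: measurable_fun_pair.
  have m2 := measurableT_comp (@measurable_resample R n k i) m1.
  have mS : measurable_fun setT (affine X s).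
    by apply/measurable_fun_tnthP => l; case: (tS l).
  exact (measurableT_comp mg (measurableT_comp mS m2)).
have fE p x : f (resample i (p, x)) =
    phi p.1 * (h p (x + t) - h p x - t * (x * h p x)).
  rewrite /f /h /resample /move_snd /= !(tset_id, tnth_tset) mulrC.
  by congr (_ * (_ - _ - _)); ring.
have he p x : `|h p x| <= (`|h p 0| + `|s|) * expR `|x|.
  rewrite -[h p x](subrK (h p 0)) (le_trans (ler_normD _ _))// addrC mulrDl.
  apply: lerD.
    by rewrite ler_peMr// (le_trans _ (expR_ge1Dx _))// lerDl.
  by rewrite (le_trans (hl _ _ _))// subr0 ler_wpM2l// ler_norm_expR.
have ih p : N.-integrable setT
    (EFin \o (fun x => h p (x + t) - h p x - t * (x * h p x))).
  have [i1 i2 i3] := integrable_normal_shift t (mh p) (he p).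
  by apply: integrableRB; [exact: integrableRB|exact: integrableRZ].
have fi p : N.-integrable setT (EFin \o (fun x => f (resample i (p, x)))).
  by under eq_fun do rewrite fE; exact: integrableRZ.
have [hi ->] := integral_resample (pi_res i) jf fi (fun p => erefl).
have le_f p : `|\int[N]_x f (resample i (p, x))| <=
    (`|s| * C * t ^+ 2) * `|phi p.1|.
  under eq_Rintegral do rewrite fE.
  by rewrite RintegralTZ// normrM mulrC ler_wpM2r// HC.
by rewrite -RintegralTZ//; apply: norm_RintegralT => //; exact: integrableRZ.
Qed.

End stein.

(** * Integration by parts *)

Section smooth.
Context {R : realType} (k : nat).
Implicit Types (g : k.-tuple R -> R) (D : 'I_k -> k.-tuple R -> R).

(* [D] is the gradient of [g]; [smooth_sqr] bounds its Euclidean norm by 1. *)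
Record smooth g D (Cg : R) := Smooth {
  smooth_lip : forall x y, `|g x - g y| <= \sum_l `|tnth x l - tnth y l| ;
  smooth_meas : forall l, measurable_fun setT (D l) ;
  smooth_sqr : forall x (v : 'I_k -> R),
    (\sum_l v l * D l x) ^+ 2 <= \sum_l v l ^+ 2 ;
  smooth_exp : forall x y,
    `|g y - g x - \sum_l (tnth y l - tnth x l) * D l x| <=
    Cg * \sum_l (tnth y l - tnth x l) ^+ 2 }.

End smooth.

Section identities.
Context {R : realType} (n k : nat) (kn : (k <= n)%N).
Local Notation Om := (n.-tuple R * k.-tuple R)%type.
Local Notation mix := (mix kn).
Local Notation w := (widen_ord kn).
Variable pi : probability Om R.
Local Notation N := (@normal_prob R 0 1).
Local Notation E f := (\int[pi]_p f p).
Hypothesis pi_res : forall i A, measurable A ->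
  pi A = (pi \x N)%E (resample i @^-1` A).
Hypothesis pi_rot : forall (i j : 'I_n) c s, i != j -> c ^+ 2 + s ^+ 2 = 1 ->
  forall A, measurable A ->
  pi A = pi ((fun p : Om => (plane_rot i j c s p.1, p.2)) @^-1` A).
Hypothesis pi_fst4 : forall i,
  pi.-integrable setT (EFin \o (fun p => tnth p.1 i ^+ 4)).
Implicit Types (c s t : R) (p : Om) (i l : 'I_k).

Variables (g : k.-tuple R -> R) (D : 'I_k -> k.-tuple R -> R) (Cg : R).
Hypothesis gD : smooth g D Cg.

Let ty (j : 'I_n) : tame 1 (fun p : Om => tnth p.1 j).
Proof. exact: tame_fst. Qed.

Let tz i : tame 1 (fun p : Om => tnth p.2 i).
Proof. exact: tame_snd. Qed.

Let it m f (tf : tame m f) (m4 : (m <= 4)%N) := integrable_tame pi_res pi_fst4 tf m4.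

(** [smooth_sqr] is tested on the l-th basis vector. *)
Lemma smooth_le1 l x : `|D l x| <= 1.
Proof.
have := smooth_sqr gD x (fun l' => (l' == l)%:R); rewrite sum_delta_mulr.
rewrite (bigD1 l)//= eqxx expr1n big1 ?addr0 => [|l' /negbTE->]; last by rewrite expr0n.
rewrite -[D l x ^+ 2]real_normK ?num_real// => D2.
by rewrite -(ler_pXn2r (ltn0Sn 1)) ?nnegrE// expr1n.
Qed.

Lemma tame_grad c s l : tame 0 (fun p => D l (mix c s p)).
Proof.
split; first exact: (measurableT_comp (smooth_meas gD l) (measurable_mix kn c s)).
by exists 1 => p; rewrite mulr1 smooth_le1.
Qed.

Lemma tame_g c s : tame 1 (fun p => g (mix c s p)).
Proof. exact: tame_lipschitz (smooth_lip gD) (tame_mix kn c s). Qed.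

(** Moving [z_i] by t changes g(S) by s t D_i(S) up to order t^2, while [stein_move_snd] with weight
    [y_j] says that the mean change is t E[z_i g(S) y_j] up to order t^2. The coefficients of t must
    agree. *)
Lemma gaussian_ibp i (j : 'I_n) c s :
  s * E (fun p => D i (mix c s p) * tnth p.1 j) =
  E (fun p => tnth p.2 i * g (mix c s p) * tnth p.1 j).
Proof.
have [C C0 HC] := stein_move_snd pi_res pi_fst4.
pose X (l : 'I_k) (y : n.-tuple R) := c * tnth y (w l).
have tX l : tame 1 (fun p : Om => X l p.1) by apply: tameZ; exact: ty.
have tDy : tame 1 (fun p => D i (mix c s p) * tnth p.1 j).
  exact: (tameM (tame_grad c s i) (ty j)).
have tzgy : tame 3 (fun p => tnth p.2 i * g (mix c s p) * tnth p.1 j).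
  exact (tameM (tameM (tz i) (tame_g c s)) (ty j)).
apply/eqP; rewrite -subr_eq0; apply/eqP.
(* The constant adds the Stein error |s| C and the Taylor error Cg s^2, the point of evaluation
   having moved by s t. *)
apply: (@eq0_small_bound _ _
  ((`|s| * C + Cg * s ^+ 2) * E (fun p : Om => `|tnth p.1 j|))) => t t0 t1.
pose Dg p := g (mix c s (move_snd i t p)) - g (mix c s p).
have tDg : tame 0 Dg := tame_move_snd s (smooth_lip gD) tX i t.
pose r p := Dg p - s * t * D i (mix c s p).
have tr : tame 0 r by apply: tameB => //; apply: tameZ; exact: tame_grad.
have r_le p : `|r p| <= Cg * (s * t) ^+ 2.
  have := smooth_exp gD (mix c s p) (mix c s (move_snd i t p)).
  under eq_bigr do rewrite affine_move_snd addrC addKr -mulrA.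
  rewrite -mulr_sumr sum_delta_mulr.
  under [in leRHS]eq_bigr do rewrite affine_move_snd addrC addKr.
  rewrite (bigD1 i)//= eqxx mulr1 big1 ?addr0// => l /negbTE->.
  by rewrite mulr0 expr0n.
have := HC g X (fun y => tnth y j) i s t (smooth_lip gD) tX (ty j).
rewrite (@eq_RintegralT _ _ _ _ _ (fun p => t * (s * (D i (mix c s p) * tnth p.1 j)
    - tnth p.2 i * g (mix c s p) * tnth p.1 j) + r p * tnth p.1 j)); last first.
  by move=> p; rewrite /r /Dg; ring.
have try : tame 1 (fun p => r p * tnth p.1 j) by exact: (tameM tr (ty j)).
have tq : tame 3 (fun p => s * (D i (mix c s p) * tnth p.1 j)
    - tnth p.2 i * g (mix c s p) * tnth p.1 j).
  by apply: tameB => //; apply: tameZ; exact: tame_le tDy.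
rewrite RintegralTD; [|exact: it (tameZ t tq) _|exact: it try _].
rewrite RintegralTZ; last exact: it tq _.
rewrite RintegralTB; [|exact: it (tameZ s tDy) _|exact: it tzgy _].
rewrite RintegralTZ; last exact: it tDy _.
set a := s * _ - _ => H.
have Er : `|E (fun p => r p * tnth p.1 j)| <= Cg * (s * t) ^+ 2 * E (fun p : Om => `|tnth p.1 j|).
  rewrite -RintegralTZ; last exact: it (tame_norm (ty j)) _.
  apply: norm_RintegralT; [exact: it try _|exact: it (tameZ _ (tame_norm (ty j))) _|].
  by move=> p; rewrite normrM ler_wpM2r.
rewrite -(ler_pM2l t0) -{1}(gtr0_norm t0) -normrM.
rewrite -[t * a](addrK (E (fun p => r p * tnth p.1 j))).
rewrite (le_trans (ler_normB _ _))// (le_trans (lerD H Er))//.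
by rewrite le_eqVlt; apply/orP; left; apply/eqP; ring.
Qed.

Lemma E_plane_rot (i j : 'I_n) c s (f : Om -> R) m :
  i != j -> c ^+ 2 + s ^+ 2 = 1 -> tame m f -> (m <= 4)%N ->
  E (fun p => f (plane_rot i j c s p.1, p.2)) = E f.
Proof.
move=> ij cs tf m4.
pose r p : Om := (plane_rot i j c s p.1, p.2).
have mr : measurable_fun setT r.
  apply: measurable_fun_pair => //.
  exact: (measurableT_comp (measurable_plane_rot i j c s)).
have [mf _] := tf; have mEf : measurable_fun setT (EFin \o f).
  exact/measurable_EFinP.
have jf := it tf m4.
have eqm (h : Om -> \bar R) :
    (\int[pi]_p h p = \int[pushforward pi r]_p h p)%E.
  by apply: eq_measure_integral => A mA _; exact: pi_rot.
rewrite /Rintegral; congr fine; rewrite [RHS]eqm integral_pushforward ?preimage_setT//.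
apply/integrableP; split; first exact: (measurableT_comp mEf mr).
case/integrableP : jf => _; rewrite eqm ge0_integral_pushforward ?preimage_setT//=.
exact: (measurableT_comp (@abse_measurable R setT) mEf).
Qed.

(** The gradient extended by zero to the coordinates of R^n beyond the first k, so that j may range
    over all of them without a case distinction. *)
Definition grad_fst (j : 'I_n) x := \sum_l (w l == j)%:R * D l x.

Lemma grad_fst_widen l x : grad_fst (w l) x = D l x.
Proof.
by rewrite /grad_fst -[RHS](sum_delta_mulr l (D ^~ x)); apply: eq_bigr => l' _;
  rewrite -val_eqE.
Qed.

Lemma tame_grad_fst c s j : tame 0 (fun p => grad_fst j (mix c s p)).
Proof. by apply: tame_sum => l; apply: tameZ; exact: tame_grad. Qed.

(** The s-term is the infinitesimal rotation applied to g; the (c - 1)-term is quadratic in the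
    angle and ends up in the error. *)
Lemma sum_plane_rot_grad (i : 'I_k) (j : 'I_n) c s (y : n.-tuple R) x : w i != j ->
  \sum_l (tnth (plane_rot (w i) j c s y) (w l) - tnth y (w l)) * D l x =
  s * (tnth y j * D i x - tnth y (w i) * grad_fst j x) +
  (c - 1) * (tnth y (w i) * D i x + tnth y j * grad_fst j x).
Proof.
move=> ij; transitivity (\sum_l ((l == i)%:R *
    (((c - 1) * tnth y (w i) + s * tnth y j) * D l x) +
    ((w l == j)%:R * D l x) * ((c - 1) * tnth y j - s * tnth y (w i)))).
  apply: eq_bigr => l _; rewrite tnth_mktuple.
  have -> : (w l == w i) = (l == i) by rewrite -val_eqE.
  have [->|li] := eqVneq l i; first by rewrite (negbTE ij)/=; ring.
  by have [->|lj] := eqVneq (w l) j; rewrite /=; ring.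
rewrite big_split/= sum_delta_mulr -mulr_suml -/(grad_fst j x); ring.
Qed.

(* Compare the mean of z_i y_j g with its value after the rotation of angle
   arcsin t in the plane (i, j), to first order in t. *)
Lemma rotation_ibp i (j : 'I_n) c s : w i != j ->
  c * E (fun p => (tnth p.1 j * D i (mix c s p) -
                   tnth p.1 (w i) * grad_fst j (mix c s p)) *
                  (tnth p.2 i * tnth p.1 j)) =
  E (fun p => tnth p.2 i * g (mix c s p) * tnth p.1 (w i)).
Proof.
move=> ij.
pose Gj := E (fun p => tnth p.2 i * g (mix c s p) * tnth p.1 j).
pose H := E (fun p => (tnth p.1 (w i) * D i (mix c s p) +
                  tnth p.1 j * grad_fst j (mix c s p)) *
                  (tnth p.2 i * tnth p.1 j)).
pose B := E (fun p => (tnth p.1 (w i) ^+ 2 + tnth p.1 j ^+ 2) *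
                      `|tnth p.2 i * tnth p.1 j|).
have tzy : tame 2 (fun p => tnth p.2 i * tnth p.1 j) := tameM (tz i) (ty j).
have tA : tame 3 (fun p => (tnth p.1 j * D i (mix c s p) -
                   tnth p.1 (w i) * grad_fst j (mix c s p)) *
                  (tnth p.2 i * tnth p.1 j)).
  rewrite -[3%N]/(1 + 2)%N; apply: tameM => //; rewrite -[1%N]/(1 + 0)%N.
  by apply: tameB; apply: tameM => //; [exact: tame_grad|exact: tame_grad_fst].
have tH : tame 3 (fun p => (tnth p.1 (w i) * D i (mix c s p) +
                  tnth p.1 j * grad_fst j (mix c s p)) *
                  (tnth p.2 i * tnth p.1 j)).
  rewrite -[3%N]/(1 + 2)%N; apply: tameM => //; rewrite -[1%N]/(1 + 0)%N.
  by apply: tameD; apply: tameM => //; [exact: tame_grad|exact: tame_grad_fst].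
have tB : tame 4 (fun p => (tnth p.1 (w i) ^+ 2 + tnth p.1 j ^+ 2) *
                      `|tnth p.2 i * tnth p.1 j|).
  rewrite -[4%N]/(2 + 2)%N; apply: tameM; last exact: tame_norm.
  by apply: tameD; exact: (tameX 2 (ty _)).
have tzgy (l : 'I_n) : tame 3 (fun p => tnth p.2 i * g (mix c s p) * tnth p.1 l).
  exact: (tameM (tameM (tz i) (tame_g c s)) (ty l)).
apply/eqP; rewrite -subr_eq0; apply/eqP; set a := c * _ - _.
(* The three terms bound, after division by t^2, the contributions (u - 1) Gj and c (u - 1) H of the
   cosine and the Taylor remainder of g. The factor [k%:R] comes from bounding each of the k
   coordinate displacements alike. *)
apply: (@eq0_small_bound _ _
  (`|Gj| + `|c * H| + `|Cg| * (c ^+ 2 * 2 * k%:R) * B)) => t t0 t1.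
pose u := Num.sqrt (1 - t ^+ 2).
have t21 : t ^+ 2 <= 1 by rewrite expr_le1// ltW.
have ut : u ^+ 2 + t ^+ 2 = 1 by rewrite sqr_sqrtr ?subr_ge0// subrK.
have u0 : 0 <= u by exact: sqrtr_ge0.
(* Since 0 <= u <= 1, 1 - u <= (1 - u) (1 + u) = 1 - u^2 = t^2. *)
have u1 : `|u - 1| <= t ^+ 2.
  rewrite distrC ger0_norm; first by nra.
  by rewrite subr_ge0 -(ler_pXn2r (ltn0Sn 1)) ?nnegrE// expr1n; have := sqr_ge0 t; lra.
pose r p : Om := (plane_rot (w i) j u t p.1, p.2).
pose A (p : Om) := (tnth p.1 j * D i (mix c s p) -
  tnth p.1 (w i) * grad_fst j (mix c s p)) * (tnth p.2 i * tnth p.1 j).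
pose H' (p : Om) := (tnth p.1 (w i) * D i (mix c s p) +
  tnth p.1 j * grad_fst j (mix c s p)) * (tnth p.2 i * tnth p.1 j).
pose q (p : Om) := g (mix c s (r p)) - g (mix c s p) - c *
  (t * (tnth p.1 j * D i (mix c s p) - tnth p.1 (w i) * grad_fst j (mix c s p)) +
  (u - 1) * (tnth p.1 (w i) * D i (mix c s p) + tnth p.1 j * grad_fst j (mix c s p))).
have tr (l : 'I_n) : tame 1 (fun p => tnth (r p).1 l).
  rewrite (_ : (fun _ => _) = (fun p =>
    if l == w i then u * tnth p.1 (w i) + t * tnth p.1 j else
    if l == j then u * tnth p.1 j - t * tnth p.1 (w i) else tnth p.1 l)).
    case: (l == w i); first by apply: tameD; exact: tameZ.
    by case: (l == j) => //; apply: tameB; exact: tameZ.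
  by apply/funext => p; rewrite tnth_mktuple.
have tgr : tame 1 (fun p => g (mix c s (r p))).
  apply: tame_lipschitz (smooth_lip gD) _ => l.
  rewrite (_ : (fun _ => _) = (fun p => c * tnth (r p).1 (w l) + s * tnth p.2 l)).
    by apply: tameD; exact: tameZ.
  by apply/funext => p; rewrite tnth_mktuple.
have tgrzy : tame 3 (fun p => g (mix c s (r p)) * (tnth p.2 i * tnth p.1 j)).
  exact: (tameM tgr tzy).
(* Only the argument of g is rotated here. [F] has the weight u y_j + t y_i, which the rotation
   sends to (u^2 + t^2) y_j = y_j; so the left integrand is F composed with the rotation, and
   invariance returns the mean of F. *)
have rot_eq : E (fun p => g (mix c s (r p)) * (tnth p.2 i * tnth p.1 j)) =
    u * Gj + t * E (fun p => tnth p.2 i * g (mix c s p) * tnth p.1 (w i)).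
  pose F (p : Om) := u * (tnth p.2 i * g (mix c s p) * tnth p.1 j) +
    t * (tnth p.2 i * g (mix c s p) * tnth p.1 (w i)).
  have tF : tame 3 F by apply: tameD; exact: tameZ.
  rewrite -!RintegralTZ -?RintegralTD; try exact: it (tameZ _ (tzgy _)) _;
    try exact: it (tzgy _) _.
  rewrite -[RHS](E_plane_rot ij ut tF)//; apply: eq_RintegralT => p.
  rewrite /F -/(r p) /= !tnth_mktuple !eqxx [j == _]eq_sym (negbTE ij).
  transitivity (g (mix c s (r p)) * (tnth p.2 i * tnth p.1 j) * (u ^+ 2 + t ^+ 2)).
    by rewrite ut mulr1.
  by ring.
have q_le p : `|q p| <= `|Cg| * (c ^+ 2 * 2 * k%:R) * t ^+ 2 *
    (tnth p.1 (w i) ^+ 2 + tnth p.1 j ^+ 2).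
  have := smooth_exp gD (mix c s p) (mix c s (r p)).
  have dE l : tnth (mix c s (r p)) l - tnth (mix c s p) l =
      c * (tnth (plane_rot (w i) j u t p.1) (w l) - tnth p.1 (w l)).
    by rewrite !tnth_mktuple /=; ring.
  under eq_bigr do rewrite dE -mulrA.
  rewrite -mulr_sumr sum_plane_rot_grad// -/(q p) => /le_trans; apply.
  rewrite (@le_trans _ _ (`|Cg| * \sum_(l < k) (c ^+ 2 * (2 * t ^+ 2 *
      (tnth p.1 (w i) ^+ 2 + tnth p.1 j ^+ 2)))))//; last first.
    rewrite sumr_const card_ord -mulr_natr le_eqVlt; apply/orP; left.
    by apply/eqP; ring.
  rewrite (@le_trans _ _ (`|Cg| * \sum_l (tnth (mix c s (r p)) l - tnth (mix c s p) l) ^+ 2))//.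
    by rewrite ler_wpM2r ?ler_norm// sumr_ge0// => l _; exact: sqr_ge0.
  rewrite ler_wpM2l// ler_sum// => l _; rewrite dE exprMn ler_wpM2l ?sqr_ge0//.
  (* Both moved coordinates are displaced by an expression of this form: (x1, x2) is (y_i, y_j) for
     one and (y_j, -y_i) for the other. *)
  have h (x1 x2 : R) : ((u - 1) * x1 + t * x2) ^+ 2 <= 2 * t ^+ 2 * (x1 ^+ 2 + x2 ^+ 2).
    have u2 : (u - 1) ^+ 2 <= t ^+ 2.
      rewrite -[(u - 1) ^+ 2]real_normK ?num_real// lerXn2r ?nnegrE ?(ltW t0)//.
      by rewrite (le_trans u1)// expr2 ler_piMr// ltW.
    have := sqr_ge0 ((u - 1) * x1 - t * x2).
    have := ler_wpM2r (sqr_ge0 x1) u2; nra.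
  rewrite tnth_mktuple; case: eqP => [->|_].
    by rewrite (_ : _ - _ = (u - 1) * tnth p.1 (w i) + t * tnth p.1 j) ?h//; ring.
  case: eqP => [->|_].
    rewrite (_ : _ - _ = (u - 1) * tnth p.1 j + t * (- tnth p.1 (w i))); last by ring.
    by rewrite (le_trans (h _ _))// sqrrN addrC.
  rewrite subrr expr0n/= mulr_ge0 ?addr_ge0 ?sqr_ge0//.
  by rewrite mulr_ge0 ?sqr_ge0//.
have tq : tame 1 q.
  apply: tameB; first by apply: tameB => //; exact: tame_g.
  apply: tameZ; rewrite -[1%N]/(1 + 0)%N.
  by apply: tameD; apply: tameZ; [apply: tameB|apply: tameD]; apply: tameM => //;
    by [exact: tame_grad|exact: tame_grad_fst].
have tqzy : tame 3 (fun p => q p * (tnth p.2 i * tnth p.1 j)) := tameM tq tzy.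
have tA' : tame 3 A := tA; have tH' : tame 3 H' := tH.
have Eq : E (fun p => q p * (tnth p.2 i * tnth p.1 j)) =
    u * Gj + t * E (fun p => tnth p.2 i * g (mix c s p) * tnth p.1 (w i)) - Gj
    - (c * t * E A + c * (u - 1) * H).
  rewrite -rot_eq /Gj /H -/H'.
  rewrite -(RintegralTZ (c * t) (it tA' isT)) -(RintegralTZ (c * (u - 1)) (it tH' isT)).
  rewrite -RintegralTD ?(it (tameZ _ tA'))// ?(it (tameZ _ tH'))//.
  rewrite -RintegralTB ?(it tgrzy)// ?(it (tzgy _))//.
  rewrite -RintegralTB; [|exact: it (tameB tgrzy (tzgy j)) _|
    exact: it (tameD (tameZ _ tA') (tameZ _ tH')) _].
  by apply: eq_RintegralT => p; rewrite /q /A /H'; ring.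
have Eq_le : `|E (fun p => q p * (tnth p.2 i * tnth p.1 j))| <=
    `|Cg| * (c ^+ 2 * 2 * k%:R) * t ^+ 2 * B.
  rewrite /B -RintegralTZ ?(it tB)//.
  apply: norm_RintegralT; [exact: it tqzy _|exact: it (tameZ _ tB) _|].
  by move=> p; rewrite normrM mulrA ler_wpM2r.
(* In the mean of q y_j z_i the terms of first order in t make up exactly -t a, so t a consists of
   second-order quantities only. *)
have ta : t * a = (u - 1) * Gj - (u - 1) * (c * H) -
    E (fun p => q p * (tnth p.2 i * tnth p.1 j)).
  by rewrite Eq /a -/A; ring.
rewrite -(ler_pM2l t0) -{1}(gtr0_norm t0) -normrM ta.
rewrite (le_trans (ler_normB _ _))//.
rewrite (le_trans (lerD (ler_normB _ _) Eq_le))// !normrM.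
rewrite (@le_trans _ _ (t ^+ 2 * `|Gj| + t ^+ 2 * `|c * H| +
    `|Cg| * (c ^+ 2 * 2 * k%:R) * t ^+ 2 * B))//.
  by rewrite lerD2r normrM lerD// ler_wpM2r// mulr_ge0.
by rewrite [`|c * H|]normrM le_eqVlt; apply/orP; left; apply/eqP; ring.
Qed.

End identities.

(** * Summed identity and bound on the drift *)

Section drift.
Context {R : realType} (n k : nat) (kn : (k <= n)%N).
Local Notation Om := (n.-tuple R * k.-tuple R)%type.
Local Notation mix := (mix kn).
Local Notation w := (widen_ord kn).
Variable pi : probability Om R.
Local Notation N := (@normal_prob R 0 1).
Local Notation E f := (\int[pi]_p f p).
Hypothesis pi_res : forall i A, measurable A ->
  pi A = (pi \x N)%E (resample i @^-1` A).
Hypothesis pi_rot : forall (i j : 'I_n) c s, i != j -> c ^+ 2 + s ^+ 2 = 1 ->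
  forall A, measurable A ->
  pi A = pi ((fun p : Om => (plane_rot i j c s p.1, p.2)) @^-1` A).
Hypothesis pi_fst4 : forall i,
  pi.-integrable setT (EFin \o (fun p => tnth p.1 i ^+ 4)).
Implicit Types (c s t : R) (p : Om) (i l : 'I_k).

Let ty (j : 'I_n) : tame 1 (fun p : Om => tnth p.1 j).
Proof. exact: tame_fst. Qed.

Let tz i : tame 1 (fun p : Om => tnth p.2 i).
Proof. exact: tame_snd. Qed.

Let it m f (tf : tame m f) (m4 : (m <= 4)%N) := integrable_tame pi_res pi_fst4 tf m4.

Definition sqnorm_fst p := \sum_(j < n) tnth p.1 j ^+ 2.
Definition fst_snd p := \sum_(l < k) tnth p.1 (w l) * tnth p.2 l.

Lemma tame_sqnorm_fst : tame 2 sqnorm_fst.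
Proof. by apply: tame_sum => j; exact: (tameX 2 (ty j)). Qed.

Lemma tame_fst_snd : tame 2 fst_snd.
Proof. by apply: tame_sum => j; exact: (tameM (ty _) (tz _)). Qed.

Section moments.
Variables (i : 'I_k) (f : Om -> R) (m : nat).
Hypotheses (tf : tame m f) (f_indep : forall p x, f (resample i (p, x)) = f p).

(** Since f does not see [z_i], it leaves the inner integral over the resampled coordinate, where
    only the mean of [N] remains. *)
Lemma E_mul_snd : (m + 1 <= 4)%N -> E (fun p => f p * tnth p.2 i) = 0.
Proof.
move=> m4; have jf := it (tameM tf (tz i)) m4.
have rE p x : f (resample i (p, x)) * tnth (resample i (p, x)).2 i = f p * x.
  by rewrite f_indep tnth_tset.
have fi p : N.-integrable setT (EFin \o (fun x => f (resample i (p, x)) *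
    tnth (resample i (p, x)).2 i)).
  under eq_fun do rewrite rE.
  by apply: integrableRZ; exact: integrable_normal_id.
have [_ ->] := integral_resample (pi_res i) jf fi (fun p => erefl).
rewrite (@eq_RintegralT _ _ _ _ _ (cst 0)) ?RintegralT_cst// => p.
under eq_Rintegral do rewrite rE.
by rewrite RintegralTZ ?normal_mean_eq0 ?mulr0//; exact: integrable_normal_id.
Qed.

Lemma E_mul_snd_sqr : (m + 2 <= 4)%N ->
  E (fun p => f p * tnth p.2 i ^+ 2) = E f.
Proof.
move=> m4; have jf := it (tameM tf (tameX 2 (tz i))) m4.
have rE p x : f (resample i (p, x)) * tnth (resample i (p, x)).2 i ^+ 2 = f p * x ^+ 2.
  by rewrite f_indep tnth_tset.
have fi p : N.-integrable setT (EFin \o (fun x => f (resample i (p, x)) *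
    tnth (resample i (p, x)).2 i ^+ 2)).
  under eq_fun do rewrite rE.
  by apply: integrableRZ; exact: integrable_normal_sqr.
have [_ ->] := integral_resample (pi_res i) jf fi (fun p => erefl).
apply: eq_RintegralT => p.
under eq_Rintegral do rewrite rE.
by rewrite RintegralTZ ?normal_var_eq1 ?mulr1//; exact: integrable_normal_sqr.
Qed.

End moments.

Lemma E_snd_sqr i : E (fun p => tnth p.2 i ^+ 2) = 1.
Proof.
rewrite -[RHS](RintegralT_cst pi) -(@E_mul_snd_sqr i (cst 1) 0)//.
  by apply: eq_RintegralT => p; rewrite mul1r.
exact: tame_cst.
Qed.

Hypothesis pi_fst2 : forall j : 'I_n, E (fun p => tnth p.1 j ^+ 2) = 1.

(** In the double sum the off-diagonal terms vanish by integrating [z_l] first; a diagonal term is E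
    y_l^2 = 1. No information on the mixed moments of Y enters. *)
Lemma E_fst_snd_sqr : E (fun p => fst_snd p ^+ 2) = k%:R.
Proof.
pose f l l' p := tnth p.1 (w l) * tnth p.1 (w l') * tnth p.2 l' * tnth p.2 l.
have tf l l' : tame 4 (f l l').
  exact: (tameM (tameM (tameM (ty _) (ty _)) (tz _)) (tz _)).
transitivity (E (fun p => \sum_l \sum_l' f l l' p)).
  apply: eq_RintegralT => p; rewrite expr2 /fst_snd mulr_suml.
  apply: eq_bigr => l _; rewrite mulr_sumr; apply: eq_bigr => l' _.
  by rewrite /f; ring.
rewrite RintegralT_sum; last first.
  by move=> l; apply: it (tame_sum _ _ (tf l)) _.
rewrite -[in RHS](card_ord k) -sum1_card natr_sum; apply: eq_bigr => l _.
rewrite RintegralT_sum; last by move=> l'; apply: it (tf _ _) _.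
rewrite (bigD1 l)//= [X in _ + X]big1 ?addr0 => [|l' l'l].
  rewrite -[1%:R](pi_fst2 (w l)) -(@E_mul_snd_sqr l _ 2 (tameX 2 (ty (w l))))//.
  by apply: eq_RintegralT => p; rewrite /f; ring.
rewrite /f (@E_mul_snd l _ 3)//; last first.
  by move=> p x; rewrite /resample/= tnth_mktuple (negbTE l'l).
exact: (tameM (tameM (ty _) (ty _)) (tz _)).
Qed.

Variables (g : k.-tuple R -> R) (D : 'I_k -> k.-tuple R -> R) (Cg : R).
Hypothesis gD : smooth g D Cg.

Definition fst_grad c s p := \sum_l tnth p.1 (w l) * D l (mix c s p).
Definition snd_grad c s p := \sum_l tnth p.2 l * D l (mix c s p).

Lemma tame_fst_grad c s : tame 1 (fst_grad c s).
Proof. by apply: tame_sum => l; exact: (tameM (ty _) (tame_grad kn gD c s l)). Qed.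

Lemma tame_snd_grad c s : tame 1 (snd_grad c s).
Proof. by apply: tame_sum => l; exact: (tameM (tz _) (tame_grad kn gD c s l)). Qed.

(** [gaussian_ibp] turns the left side into the sum of the [G l], and [rotation_ibp] writes each
    [G l] in n - 1 ways, one for each j other than [w l]. Adding these expressions over j assembles
    |Y|^2 and X.G. *)
Lemma fst_grad_identity c s :
  (n%:R - 1) * (s * E (fst_grad c s)) =
  c * E (fun p => sqnorm_fst p * snd_grad c s p - fst_snd p * fst_grad c s p).
Proof.
pose G l := E (fun p => tnth p.2 l * g (mix c s p) * tnth p.1 (w l)).
have EG : s * E (fst_grad c s) = \sum_l G l.
  rewrite RintegralT_sum => [|l]; last exact: it (tameM (ty _) (tame_grad kn gD c s l)) _.
  rewrite mulr_sumr; apply: eq_bigr => l _.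
  rewrite /G -(gaussian_ibp kn pi_res pi_fst4 gD); congr (_ * _).
  by apply: eq_RintegralT => p; rewrite mulrC.
pose A l (j : 'I_n) p := (tnth p.1 j * D l (mix c s p) -
    tnth p.1 (w l) * grad_fst kn D j (mix c s p)) * (tnth p.2 l * tnth p.1 j).
have tA l j : tame 3 (A l j).
  rewrite -[3%N]/(1 + 2)%N; apply: tameM; last exact: (tameM (tz _) (ty _)).
  rewrite -[1%N]/(1 + 0)%N; apply: tameB; apply: tameM => //.
    exact: (tame_grad kn gD c s l).
  exact: (tame_grad_fst kn gD c s j).
have EA l j : w l != j -> c * E (A l j) = G l.
  exact: (rotation_ibp pi_res pi_rot pi_fst4 gD).
(* The index j = [w l] gives no rotation, but its term vanishes identically. Hence the sum may run
   over all j while counting [G l] only n - 1 times. *)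
have A0 l : E (A l (w l)) = 0.
  rewrite -[RHS](RintegralT_cst pi); apply: eq_RintegralT => p.
  by rewrite /A grad_fst_widen subrr mul0r.
have EA_sum l : c * E (fun p => \sum_j A l j p) = (n%:R - 1) * G l.
  rewrite RintegralT_sum => [|j]; last exact: it (tA l j) _.
  rewrite (bigD1 (w l))//= A0 add0r mulr_sumr.
  under eq_bigr do rewrite EA 1?eq_sym//.
  rewrite sumr_const cardC1 card_ord -[LHS]mulr_natl; congr (_ * _).
  by rewrite -subn1 natrB//; exact: leq_ltn_trans (ltn_ord (w l)).
rewrite EG mulr_sumr.
under eq_bigr do rewrite -EA_sum.
rewrite -mulr_sumr -RintegralT_sum => [|l]; last exact: it (tame_sum _ _ (tA l)) _.
congr (_ * _); apply: eq_RintegralT => p.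
rewrite /sqnorm_fst /snd_grad /fst_snd /fst_grad mulr_sumr mulr_suml -sumrB.
apply: eq_bigr => l _; rewrite /A.
(* The extension by zero lets X.G be written as a sum over all n coordinates, to match the sum over
   j. *)
have -> : \sum_l0 tnth p.1 (w l0) * D l0 (mix c s p) =
    \sum_j tnth p.1 j * grad_fst kn D j (mix c s p).
  under [RHS]eq_bigr do rewrite mulr_sumr.
  rewrite exchange_big/=; apply: eq_bigr => l0 _.
  rewrite -[LHS](sum_delta_mulr (w l0) (fun j => tnth p.1 j * D l0 (mix c s p))).
  by apply: eq_bigr => j _; rewrite [w l0 == j]eq_sym; ring.
rewrite mulr_suml mulr_sumr -sumrB; apply: eq_bigr => j _; ring.
Qed.

Lemma drift_identity c s :
  (n%:R - 1) * (c * E (snd_grad c s) - s * E (fst_grad c s)) =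
  c * E (fun p => (n%:R - 1 - sqnorm_fst p) * snd_grad c s p +
                  fst_snd p * fst_grad c s p).
Proof.
rewrite mulrBr fst_grad_identity mulrCA -mulrBr; congr (_ * _).
have t1 : tame 3 (fun p => sqnorm_fst p * snd_grad c s p).
  exact: (tameM tame_sqnorm_fst (tame_snd_grad c s)).
have t2 : tame 3 (fun p => fst_snd p * fst_grad c s p).
  exact: (tameM tame_fst_snd (tame_fst_grad c s)).
rewrite -RintegralTZ ?(it (tame_snd_grad c s))//.
rewrite -RintegralTB; [|exact: it (tameZ _ (tame_snd_grad c s)) _|exact: it (tameB t1 t2) _].
by apply: eq_RintegralT => p; ring.
Qed.

Variable a : R.
Hypothesis pi_var : E (fun p => (sqnorm_fst p - n%:R) ^+ 2) <= a.
Hypothesis k_gt0 : (0 < k)%N.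

Lemma drift_bound c s :
  `|E (fun p => (n%:R - 1 - sqnorm_fst p) * snd_grad c s p +
                  fst_snd p * fst_grad c s p)| <= k%:R * (Num.sqrt a + 2).
Proof.
have a0 : 0 <= a by apply: le_trans pi_var; apply: Rintegral_ge0 => p _; exact: sqr_ge0.
have k1 : 1 <= k%:R :> R by rewrite ler1n.
set V := fun p => (n%:R - 1 - sqnorm_fst p) ^+ 2.
have tV0 : tame 2 (fun p => n%:R - 1 - sqnorm_fst p).
  by apply: tameB; [exact: tame_cst|exact: tame_sqnorm_fst].
have tV : tame 4 V by exact: (tameX 2 tV0).
have tq1 : tame 2 (fun p => sqnorm_fst p - n%:R).
  by apply: tameB; [exact: tame_sqnorm_fst|exact: tame_cst].
have EV : E V <= a + 1.
  (* As |Y|^2 has mean n, moving the centre from n to n - 1 adds exactly 1 to the second moment. *)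
  have -> : E V = E (fun p => (sqnorm_fst p - n%:R) ^+ 2 + 2 * (sqnorm_fst p - n%:R) + 1).
    by apply: eq_RintegralT => p; rewrite /V; ring.
  have i1 := it (tameX 2 tq1) isT.
  have i2 := it (tameZ 2 tq1) isT.
  rewrite RintegralTD; [|exact: integrableRD|exact: integrableR_cst].
  rewrite RintegralTD// RintegralT_cst RintegralTZ ?(it tq1)//.
  rewrite RintegralTB ?(it tame_sqnorm_fst)//; last exact: integrableR_cst.
  rewrite RintegralT_cst RintegralT_sum => [|j]; last exact: it (tameX 2 (ty j)) _.
  under eq_bigr do rewrite pi_fst2.
  by rewrite sumr_const card_ord subrr mulr0 addr0 lerD2r.
pose S p := \sum_(l < k) tnth p.2 l ^+ 2.
pose Q p := \sum_(l < k) tnth p.1 (w l) ^+ 2.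
have tS : tame 2 S by apply: tame_sum => l; exact: (tameX 2 (tz l)).
have tQ : tame 2 Q by apply: tame_sum => l; exact: (tameX 2 (ty _)).
have ES : E S = k%:R.
  rewrite RintegralT_sum => [|l]; last exact: it (tameX 2 (tz l)) _.
  under eq_bigr do rewrite E_snd_sqr.
  by rewrite sumr_const card_ord.
have EQ : E Q = k%:R.
  rewrite RintegralT_sum => [|l]; last exact: it (tameX 2 (ty _)) _.
  under eq_bigr do rewrite pi_fst2.
  by rewrite sumr_const card_ord.
(* A convenient upper bound for sqrt(a + 1): from a + 1 <= tau^2 the first term of [b] has mean at
   most tau / 2. *)
pose tau := Num.sqrt a + 1.
have tau0 : 0 < tau by rewrite ltr_wpDl.
(* AM-GM with weight [tau] turns the Cauchy-Schwarz bounds into pointwise ones. *)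
pose b p := (tau^-1 / 2) * V p + (tau / 2) * S p + 2^-1 * (fst_snd p ^+ 2 + Q p).
have tb : tame 4 b.
  apply: tameD; first by apply: tameD; apply: tameZ => //; exact: tame_le tS.
  by apply: tameZ; apply: tameD; [exact: (tameX 2 tame_fst_snd)|exact: tame_le tQ].
(* The three means are at most tau / 2, tau k / 2 and k; with k >= 1 their sum is at most k (tau +
   1). *)
have le_b : E b <= k%:R * (Num.sqrt a + 2).
  rewrite RintegralTD; [|exact: it (tameD (tameZ _ tV) (tameZ _ (tame_le _ tS))) _|
    exact: it (tameZ _ (tameD (tameX 2 tame_fst_snd) (tame_le _ tQ))) _].
  rewrite RintegralTD; [|exact: it (tameZ _ tV) _|exact: it (tameZ _ tS) _].
  rewrite !RintegralTZ ?(it tV)// ?(it tS)//; last first.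
    exact: it (tameD (tameX 2 tame_fst_snd) (tame_le _ tQ)) _.
  rewrite RintegralTD ?(it tQ)// ?(it (tameX 2 tame_fst_snd))//.
  rewrite ES EQ E_fst_snd_sqr.
  have : tau^-1 / 2 * E V <= tau / 2.
    rewrite mulrAC ler_wpM2r// mulrC ler_pdivrMr// -expr2 (le_trans EV)//.
    rewrite /tau sqrrD1 sqr_sqrtr//; have := sqrtr_ge0 a; lra.
  have := sqrtr_ge0 a; rewrite /tau; nra.
apply: (le_trans _ le_b); apply: norm_RintegralT.
- apply: it (_ : tame 3 _) _ => //; apply: tameD.
    exact: (tameM tV0 (tame_snd_grad c s)).
  exact: (tameM tame_fst_snd (tame_fst_grad c s)).
- exact: it tb _.
move=> p; rewrite (le_trans (ler_normD _ _))// /b lerD//.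
  have h1 : snd_grad c s p ^+ 2 <= S p by exact: smooth_sqr gD _ _.
  rewrite normrM; set x := `|_|; set y := `|_|.
  have -> : V p = x ^+ 2 by rewrite /V /x real_normK ?num_real.
  have h2 : y ^+ 2 <= S p by rewrite /y real_normK ?num_real.
  rewrite (@le_trans _ _ (tau^-1 / 2 * x ^+ 2 + tau / 2 * y ^+ 2))//.
    rewrite -subr_ge0 (_ : _ - _ = tau^-1 / 2 * (x - tau * y) ^+ 2).
      by rewrite mulr_ge0 ?sqr_ge0// divr_ge0// invr_ge0 ltW.
    by field; rewrite gt_eqF.
  by rewrite lerD2l ler_wpM2l// divr_ge0// ltW.
have h1 : fst_grad c s p ^+ 2 <= Q p by exact: smooth_sqr gD _ _.
rewrite normrM; set x := `|_|; set y := `|_|.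
have -> : fst_snd p ^+ 2 = x ^+ 2 by rewrite /x real_normK ?num_real.
have h2 : y ^+ 2 <= Q p by rewrite /y real_normK ?num_real.
have := sqr_ge0 (x - y); nra.
Qed.

End drift.

(** * Interpolation *)

Section real_analysis.
Context {R : realType}.

Lemma is_derive0_quadratic (f : R -> R) (x C : R) :
  (forall y, `|f y - f x| <= C * (y - x) ^+ 2) -> is_derive x 1 f 0.
Proof.
move=> fC.
have H : (fun h : R => h^-1 *: ((f \o shift x) (h *: 1) - f x)) @ 0^' --> (0 : R).
  apply/cvgrPdist_le => /= e e0.
  have C1 : 0 < `|C| + 1 by rewrite ltr_wpDl.
  near=> h.
  have h0 : h != 0 by near: h; exact: nbhs_dnbhs_neq.
  rewrite sub0r normrN normrZ /= [h *: 1]mulr1.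
  rewrite normfV ler_pdivrMl ?normr_gt0// (le_trans (fC _))// addrK.
  rewrite -[h ^+ 2]real_normK ?num_real// expr2 mulrCA ler_wpM2l//.
  have : `|h| <= e / (`|C| + 1).
    by near: h; apply: dnbhs0_le; rewrite divr_gt0.
  rewrite ler_pdivlMr// mulrC; apply: le_trans.
  by rewrite ler_wpM2r// (le_trans (ler_norm _))// lerDl.
by apply: DeriveDef; [apply/cvg_ex; exists 0|exact: cvg_lim].
Unshelve. all: by end_near.
Qed.

Lemma lipschitz_is_derive (f df : R -> R) :
  (forall x : R, is_derive x 1 f (df x)) -> (forall x, `|df x| <= 1) ->
  forall x y, `|f x - f y| <= `|x - y|.
Proof.
move=> fd df1.
suff H x y : x <= y -> `|f y - f x| <= `|y - x|.
  by move=> x y; have [/H|/ltW/H//] := leP x y; rewrite distrC [`|y - x|]distrC.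
move=> xy; have [|c _ ->] := @MVT_segment _ f df x y xy (fun z _ => fd z).
  by apply: derivable_within_continuous => z _; have [] := fd z.
by rewrite normrM ler_piMl.
Qed.

Lemma sin_lipschitz (x y : R) : `|sin x - sin y| <= `|x - y|.
Proof. exact: (lipschitz_is_derive (@is_derive_sin R) (@cos_max R)). Qed.

Lemma cos_lipschitz (x y : R) : `|cos x - cos y| <= `|x - y|.
Proof.
apply: (lipschitz_is_derive (@is_derive_cos R)) => z.
by rewrite normrN sin_max.
Qed.

Lemma is_derive_cos_sin (r : R -> R) (x a b : R) : is_derive x 1 r 0 ->
  is_derive x 1 (r \+ ((cos \* cst a) \+ (sin \* cst b))) (cos x * b - sin x * a).
Proof.
move=> dr.
have da := is_deriveM (is_derive_cos x) (is_derive_cst a x (1 : R)).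
have db := is_deriveM (is_derive_sin x) (is_derive_cst b x (1 : R)).
have [d1 d2] := is_deriveD dr (is_deriveD da db).
apply: DeriveDef; first exact: d1.
rewrite -[RHS](_ : 0 + (cos x *: 0 + cst a x *: - sin x +
  (sin x *: 0 + cst b x *: cos x)) = _); first exact: d2.
by rewrite !scaler0 /cst /GRing.scale/=; ring.
Qed.

Lemma is_derive_sub_sin (f : R -> R) (x d b c : R) : is_derive x 1 f d ->
  is_derive x 1 ((f \* cst b) \+ (sin \* cst c)) (b * d + c * cos x).
Proof.
move=> df.
have db := is_deriveM df (is_derive_cst b x (1 : R)).
have dc := is_deriveM (is_derive_sin x) (is_derive_cst c x (1 : R)).
have [d1 d2] := is_deriveD db dc.
apply: DeriveDef; first exact: d1.
rewrite -[RHS](_ : f x *: 0 + cst b x *: d + (sin x *: 0 + cst c x *: cos x) = _).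
  exact: d2.
by rewrite !scaler0 /cst /GRing.scale/=; ring.
Qed.

End real_analysis.

Section path.
Context {R : realType} (n k : nat) (kn : (k <= n)%N).
Local Notation Om := (n.-tuple R * k.-tuple R)%type.
Local Notation mix := (mix kn).
Local Notation w := (widen_ord kn).
Variable pi' : probability Om R.
Local Notation N := (@normal_prob R 0 1).
Local Notation E f := (\int[pi']_p f p).
Hypothesis pi_res : forall i A, measurable A ->
  pi' A = (pi' \x N)%E (resample i @^-1` A).
Hypothesis pi_rot : forall (i j : 'I_n) c s, i != j -> c ^+ 2 + s ^+ 2 = 1 ->
  forall A, measurable A ->
  pi' A = pi' ((fun p : Om => (plane_rot i j c s p.1, p.2)) @^-1` A).
Hypothesis pi_fst4 : forall i,
  pi'.-integrable setT (EFin \o (fun p => tnth p.1 i ^+ 4)).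
Hypothesis pi_fst2 : forall j : 'I_n, E (fun p => tnth p.1 j ^+ 2) = 1.
Variable a : R.
Hypothesis pi_var : E (fun p => (sqnorm_fst p - n%:R) ^+ 2) <= a.
Hypotheses (k_gt0 : (0 < k)%N) (n_ge2 : (2 <= n)%N).
Variables (g : k.-tuple R -> R) (D : 'I_k -> k.-tuple R -> R) (Cg : R).
Hypothesis gD : smooth g D Cg.
Implicit Types (c s t x y : R) (p : Om) (i l : 'I_k).

Let it m f (tf : tame m f) (m4 : (m <= 4)%N) := integrable_tame pi_res pi_fst4 tf m4.

(** The pointwise expansion of g is integrated. By Cauchy-Schwarz in the plane, the square of (c' -
    c) y_l + (s' - s) z_l is at most ((c' - c)^2 + (s' - s)^2) (y_l^2 + z_l^2), and y_l^2 + z_l^2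
    has mean 2. *)
Lemma mix_expansion c s c' s' :
  `|E (fun p => g (mix c' s' p)) - E (fun p => g (mix c s p)) -
    ((c' - c) * E (fst_grad kn D c s) + (s' - s) * E (snd_grad kn D c s))| <=
  `|Cg| * (2 * k%:R) * ((c' - c) ^+ 2 + (s' - s) ^+ 2).
Proof.
have tg := tame_g kn gD.
have tf : tame 1 (fst_grad kn D c s) := tame_fst_grad kn gD c s.
have ts : tame 1 (snd_grad kn D c s) := tame_snd_grad kn gD c s.
pose V p := \sum_(l < k) (tnth p.1 (w l) ^+ 2 + tnth p.2 l ^+ 2).
have tV : tame 2 V.
  apply: tame_sum => l; apply: tameD.
    exact: (tameX 2 (tame_fst k (w l))).
  exact: (tameX 2 (tame_snd n l)).
have EV : E V = 2 * k%:R.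
  rewrite RintegralT_sum => [|l]; last first.
    apply: it (_ : tame 2 _) _ => //; apply: tameD.
      exact: (tameX 2 (tame_fst k (w l))).
    exact: (tameX 2 (tame_snd n l)).
  rewrite (eq_bigr (fun=> 2)) ?sumr_const ?card_ord ?mulr_natr// => l _.
  rewrite RintegralTD ?(it (tameX 2 (tame_fst k (w l))))//
    ?(it (tameX 2 (tame_snd n l)))//.
  by rewrite pi_fst2 (E_snd_sqr pi_res pi_fst4).
have i1 := it (tg c' s') isT; have i2 := it (tg c s) isT.
have i3 := it (tameZ (c' - c) tf) isT; have i4 := it (tameZ (s' - s) ts) isT.
rewrite -!RintegralTZ ?(it tf)// ?(it ts)//.
rewrite -RintegralTB// -RintegralTD// -RintegralTB; [|exact: integrableRB|exact: integrableRD].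
rewrite mulrAC -EV -RintegralTZ ?(it tV)//.
apply: norm_RintegralT.
- by apply: integrableRB; [exact: integrableRB|exact: integrableRD].
- exact: it (tameZ _ tV) _.
move=> p; have := smooth_exp gD (mix c s p) (mix c' s' p).
have dE l : tnth (mix c' s' p) l - tnth (mix c s p) l =
    (c' - c) * tnth p.1 (w l) + (s' - s) * tnth p.2 l.
  by rewrite !tnth_mktuple; ring.
under eq_bigr do rewrite dE mulrDl -!mulrA.
rewrite big_split/= -!mulr_sumr -/(fst_grad kn D c s p) -/(snd_grad kn D c s p).
move=> /le_trans; apply.
rewrite (@le_trans _ _ (`|Cg| * \sum_l (tnth (mix c' s' p) l - tnth (mix c s p) l) ^+ 2))//.
  by rewrite ler_wpM2r ?ler_norm// sumr_ge0// => l _; exact: sqr_ge0.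
rewrite -mulrA ler_wpM2l// mulr_sumr ler_sum// => l _; rewrite dE.
have := sqr_ge0 ((c' - c) * tnth p.2 l - (s' - s) * tnth p.1 (w l)); nra.
Qed.

Let u x := E (fun p => g (mix (cos x) (sin x) p)).
Let du x := cos x * E (snd_grad kn D (cos x) (sin x)) -
  sin x * E (fst_grad kn D (cos x) (sin x)).

(** With the gradient means frozen at x as A and B, the path minus A cos + B sin varies only
    quadratically near x, so its derivative there is 0. The derivative of [u] is that of the
    explicit trigonometric part. *)
Lemma is_derive_path x : is_derive x 1 u (du x).
Proof.
set A := E (fst_grad kn D (cos x) (sin x)).
set B := E (snd_grad kn D (cos x) (sin x)).
pose r y := u y - (cos y * A + sin y * B).
have dr : is_derive x 1 r 0.
  apply: (@is_derive0_quadratic _ _ _ (`|Cg| * (2 * k%:R) * 2)) => y.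
  have := mix_expansion (cos x) (sin x) (cos y) (sin y).
  rewrite -/A -/B -/(u x) -/(u y) (_ : _ - _ = r y - r x); last by rewrite /r; ring.
  move=> /le_trans; apply; rewrite -[leRHS]mulrA ler_wpM2l ?mulr_ge0//.
  rewrite mulr2n mulrDl mul1r -![(_ - _) ^+ 2]real_normK ?num_real//.
  by rewrite lerD// lerXn2r ?nnegrE// ?cos_lipschitz ?sin_lipschitz.
have -> : u = r \+ ((cos \* cst A) \+ (sin \* cst B)).
  by apply/funext => y; rewrite /r /= subrK.
exact: is_derive_cos_sin.
Qed.

(** Stands for integrating |du| <= K cos over [0, pi/2]: for |b| <= 1 the mean value theorem shows
    that b u - K sin does not increase from 0 to pi/2, and b = 1 and b = -1 give the two signs. *)
Lemma path_bound : `|u (pi / 2) - u 0| <= k%:R * (Num.sqrt a + 2) / (n%:R - 1).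
Proof.
pose K := k%:R * (Num.sqrt a + 2) / (n%:R - 1); rewrite -/K.
have n1 : 0 < n%:R - 1 :> R by rewrite subr_gt0 ltr1n.
have du_le x : 0 <= cos x -> `|du x| <= K * cos x.
  move=> cx; rewrite -(ler_pM2l n1) -{1}(gtr0_norm n1) -normrM.
  rewrite (drift_identity kn pi_res pi_rot pi_fst4 gD) normrM ger0_norm//.
  rewrite [leRHS]mulrA (_ : _ * K = k%:R * (Num.sqrt a + 2)); last first.
    by rewrite mulrC /K divfK ?gt_eqF.
  rewrite mulrC ler_wpM2r//.
  exact: (drift_bound kn pi_res pi_fst4 pi_fst2 gD pi_var k_gt0).
have pi2 : 0 <= pi / 2 :> R by rewrite divr_ge0// pi_ge0.
have cu e : is_derive (e : R) 1 u (du e) by exact: is_derive_path.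
have ub b : `|b| <= 1 -> b * (u (pi / 2) - u 0) <= K.
  move=> b1; pose f := (u \* cst b) \+ (sin \* cst (- K)).
  have df (x : R) : is_derive x 1 f (b * du x + (- K) * cos x).
    exact: is_derive_sub_sin.
  have [|c + fE] := @MVT_segment _ f _ 0 (pi / 2) pi2 (fun x _ => df x).
    by apply: derivable_within_continuous => z _; have [] := df z.
  rewrite in_itv/= => /andP[c0 c1].
  have cc : 0 <= cos c.
    by rewrite cos_ge0_pihalf// c1 andbT (le_trans _ c0)// oppr_le0.
  have : f (pi / 2) - f 0 <= 0.
    rewrite fE mulr_le0_ge0 ?subr0// mulNr subr_le0 (le_trans (ler_norm _))// normrM.
    by rewrite (le_trans _ (du_le _ cc))// ler_piMl.
  have -> : f (pi / 2) - f 0 = b * (u (pi / 2) - u 0) - K.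
    by rewrite /f/= sin_pihalf sin0; ring.
  by rewrite subr_le0.
have := ub 1; have := ub (-1); rewrite normrN normr1 lexx => /(_ isT) h1 /(_ isT).
by rewrite ler_norml; lra.
Qed.

End path.

(** * Mollification *)

Section enorm.
Context {R : realType} (k : nat).
Implicit Types x y : k.-tuple R.

Lemma enorm_sqr x : enorm x ^+ 2 = \sum_i tnth x i ^+ 2.
Proof. by rewrite /enorm sqr_sqrtr// sumr_ge0// => i _; exact: sqr_ge0. Qed.

Lemma sum_sqr_le_sqr_sum (r : seq 'I_k) (v : 'I_k -> R) :
  \sum_(i <- r) v i ^+ 2 <= (\sum_(i <- r) `|v i|) ^+ 2.
Proof.
elim: r => [|i r IH]; first by rewrite !big_nil expr0n.
rewrite !big_cons sqrrD -[v i ^+ 2]real_normK ?num_real//.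
rewrite -addrA lerD2l (le_trans IH)// lerDr mulrn_wge0// mulr_ge0//.
exact: sumr_ge0.
Qed.

Lemma enorm_le_sum x : enorm x <= \sum_i `|tnth x i|.
Proof.
rewrite -(ler_pXn2r (ltn0Sn 1)) ?nnegrE ?sqrtr_ge0 ?sumr_ge0//.
by rewrite enorm_sqr sum_sqr_le_sqr_sum.
Qed.

Lemma lipschitz1_sum (g : k.-tuple R -> R) : lipschitz1 g ->
  forall x y, `|g x - g y| <= \sum_l `|tnth x l - tnth y l|.
Proof.
move=> gl x y; rewrite (le_trans (gl x y))// (le_trans (enorm_le_sum _))//.
by apply: ler_sum => l _; rewrite tnth_mktuple.
Qed.

Lemma sqr_sum_le (v : 'I_k -> R) :
  (\sum_i `|v i|) ^+ 2 <= k%:R * \sum_i v i ^+ 2.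
Proof.
rewrite expr2 mulr_suml.
apply: (@le_trans _ _ (\sum_i \sum_j (v i ^+ 2 + v j ^+ 2) / 2)).
  apply: ler_sum => i _; rewrite mulr_sumr; apply: ler_sum => j _.
  rewrite -[v i ^+ 2]real_normK ?num_real// -[v j ^+ 2]real_normK ?num_real//.
  by have := sqr_ge0 (`|v i| - `|v j|); lra.
under eq_bigr do rewrite -mulr_suml big_split/= sumr_const card_ord.
rewrite -mulr_suml big_split/= sumr_const card_ord sumrMnl -[X in X + X]mulr_natl; lra.
Qed.

End enorm.

(** The one-sided limit step, used for the norm of the mollified gradient and for removing the
    mollification. *)
Lemma le0_small_bound {R : realFieldType} (a C : R) :
  (forall t, 0 < t -> t <= 1 -> a <= C * t) -> a <= 0.
Proof.
move=> H; rewrite leNgt; apply/negP => a0.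
have /eqP : a = 0.
  by apply: (@eq0_small_bound _ _ C) => t t0 t1; rewrite gtr0_norm// H.
by rewrite gt_eqF.
Qed.

Section mollify.
Context {R : realType} (n k : nat).
Local Notation Om := (n.-tuple R * k.-tuple R)%type.
Variable pi : probability Om R.
Local Notation N := (@normal_prob R 0 1).
Local Notation E f := (\int[pi]_p f p).
Hypothesis pi_res : forall i A, measurable A ->
  pi A = (pi \x N)%E (resample i @^-1` A).
Hypothesis pi_fst4 : forall i,
  pi.-integrable setT (EFin \o (fun p => tnth p.1 i ^+ 4)).
Implicit Types (x y : k.-tuple R) (i l : 'I_k).
Variables (g : k.-tuple R -> R) (d : R).
Hypotheses (gl : lipschitz1 g) (d0 : 0 < d).

Let it m (f : Om -> R) (tf : tame m f) (m4 : (m <= 4)%N) :=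
  integrable_tame pi_res pi_fst4 tf m4.
Let g_lip := lipschitz1_sum gl.

Definition blur x : Om -> k.-tuple R := affine (fun l _ => tnth x l) d.
(** Convolution with the normal law of covariance d^2 times the identity; the Gaussian component of
    [pi] supplies the noise. *)
Definition mollify x := E (fun p => g (blur x p)).
(** The gradient after Gaussian integration by parts: the derivative falls on the density, so the
    formula makes sense for g merely Lipschitz. *)
Definition mollify_grad i x := d^-1 * E (fun p => tnth p.2 i * g (blur x p)).

Let tg x : tame 1 (fun p => g (blur x p)).
Proof.
by apply: tame_lipschitz => // l; apply: tame_affine; exact: tame_cst.
Qed.

Let tz i : tame 1 (fun p : Om => tnth p.2 i). Proof. exact: tame_snd. Qed.

Let tzg i x : tame 2 (fun p => tnth p.2 i * g (blur x p)).
Proof. exact: (tameM (tz i) (tg x)). Qed.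

Definition abs_snd_mean := E (fun p : Om => \sum_l `|tnth p.2 l|).

Let tM : tame 1 (fun p : Om => \sum_l `|tnth p.2 l|).
Proof. by apply: tame_sum => l; exact/tame_norm/tz. Qed.

Let M0 : 0 <= abs_snd_mean.
Proof. by apply: Rintegral_ge0 => p _; exact: sumr_ge0. Qed.

Lemma mollify_close x : `|mollify x - g x| <= d * abs_snd_mean.
Proof.
rewrite -[g x](RintegralT_cst pi) -RintegralTB; [|exact: it (tg x) _|exact: integrableR_cst].
rewrite -RintegralTZ; last exact: it tM _.
apply: norm_RintegralT; [|exact: it (tameZ _ tM) _|].
  by apply: integrableRB; [exact: it (tg x) _|exact: integrableR_cst].
move=> p; rewrite (le_trans (g_lip _ _))// mulr_sumr ler_sum// => l _.
by rewrite tnth_mktuple addrC addKr normrM gtr0_norm.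
Qed.

(** Both points receive the same noise, so their difference is unchanged and the Euclidean constant
    1 survives. *)
Lemma mollify_lipschitz : lipschitz1 mollify.
Proof.
move=> x y; rewrite -RintegralTB; [|exact: it (tg x) _|exact: it (tg y) _].
rewrite -(RintegralT_cst pi (enorm (tsub x y))).
apply: norm_RintegralT; [exact: it (tameB (tg x) (tg y)) _|exact: integrableR_cst|].
move=> p; rewrite (le_trans (gl _ _))// (_ : tsub _ _ = tsub x y)//.
by apply: eq_from_tnth => l; rewrite !tnth_mktuple opprD addrACA subrr addr0.
Qed.

(** Serves twice in [mollify_smooth]: for the measurability of the gradient, and to replace the
    gradient at an intermediate point by the one at x. *)
Lemma mollify_grad_lipschitz i x y :
  `|mollify_grad i x - mollify_grad i y| <=
  d^-1 * abs_snd_mean * \sum_l `|tnth x l - tnth y l|.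
Proof.
rewrite -mulrBr normrM gtr0_norm ?invr_gt0// -mulrA ler_wpM2l ?invr_ge0 ?(ltW d0)//.
rewrite -RintegralTB; [|exact: it (tzg i x) _|exact: it (tzg i y) _].
rewrite [leRHS]mulrC -(RintegralTZ _ (it tM isT)).
apply: norm_RintegralT; [exact: it (tameB (tzg i x) (tzg i y)) _|exact: it (tameZ _ tM) _|].
move=> p; rewrite -mulrBr normrM mulrC ler_pM//.
  rewrite (le_trans (g_lip _ _))// ler_sum// => l _.
  by rewrite !tnth_mktuple opprD addrACA subrr addr0.
by rewrite (bigD1 i)//= lerDl sumr_ge0.
Qed.

(** Moving the point by t along axis i amounts to moving the noise [z_i] by t / d. [stein_move_snd]
    with weight 1 and slope d gives the error d C (t / d)^2 = (C / d) t^2. *)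
Lemma mollify_partial : exists2 C, 0 <= C & forall i x y,
  (forall l, l != i -> tnth y l = tnth x l) ->
  `|mollify y - mollify x - (tnth y i - tnth x i) * mollify_grad i x| <=
  C * (tnth y i - tnth x i) ^+ 2.
Proof.
have [C C0 HC] := stein_move_snd pi_res pi_fst4.
exists (C / d) => [|i x y xy]; first by rewrite divr_ge0// ltW.
set t := tnth y i - tnth x i.
have := HC g (fun l _ => tnth x l) (cst 1) i d (t / d) g_lip
  (fun l => tame_cst n k 1 (tnth x l)) (tame_cst n k 1 1).
rewrite (@eq_RintegralT _ _ _ _ _ (fun p => g (blur y p) - g (blur x p) -
   (t / d) * (tnth p.2 i * g (blur x p)))); last first.
  move=> p; rewrite mulr1; congr (g _ - _ - _); apply: eq_from_tnth => l.
  rewrite affine_move_snd (_ : d * (t / d) = t); last by rewrite mulrC divfK ?gt_eqF.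
  rewrite !tnth_mktuple.
  have [->|/xy ->] := eqVneq l i; last by rewrite mulr0 addr0.
  by rewrite /t /=; ring.
rewrite RintegralTB; [|exact: it (tameB (tg y) (tg x)) _|exact: it (tameZ _ (tzg i x)) _].
rewrite RintegralTB; [|exact: it (tg y) _|exact: it (tg x) _].
rewrite RintegralTZ; last exact: it (tzg i x) _.
rewrite (@eq_RintegralT _ _ _ _ (fun p => `|cst 1 p.1|) (cst 1)); last first.
  by move=> p; rewrite normr1.
rewrite RintegralT_cst mulr1 (gtr0_norm d0) -/(mollify _) -/(mollify _) -mulrA => H.
rewrite /mollify_grad (le_trans H)// le_eqVlt; apply/orP; left; apply/eqP.
by field; rewrite gt_eqF.
Qed.

(* The gradient expansion is obtained one coordinate at a time, along the
   vectors [z m] that agree with y before m and with x from m on. *)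
Lemma mollify_smooth : exists Cg, smooth mollify mollify_grad Cg.
Proof.
have [C C0 HC] := mollify_partial.
pose M := d^-1 * abs_snd_mean.
have M1 : 0 <= M by rewrite mulr_ge0// invr_ge0 ltW.
(* C collects the one-coordinate errors. Transporting each partial derivative to x costs M S1 |y_m -
   x_m|, in total M S1^2, and [sqr_sum_le] bounds S1^2 by k times the sum of squares. *)
pose Cg := C + M * k%:R.
have Cg0 : 0 <= Cg by rewrite addr_ge0// mulr_ge0.
have expn x y : `|mollify y - mollify x -
    \sum_l (tnth y l - tnth x l) * mollify_grad l x| <=
    Cg * \sum_l (tnth y l - tnth x l) ^+ 2.
  pose z (m : nat) := [tuple if (l < m)%N then tnth y l else tnth x l | l < k].
  pose S1 := \sum_l `|tnth y l - tnth x l|.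
  have step (m : 'I_k) : `|mollify (z m.+1) - mollify (z m) -
      (tnth y m - tnth x m) * mollify_grad m x| <=
      C * (tnth y m - tnth x m) ^+ 2 + M * S1 * `|tnth y m - tnth x m|.
    have zm : tnth (z m) m = tnth x m by rewrite tnth_mktuple ltnn.
    have zm1 : tnth (z m.+1) m = tnth y m by rewrite tnth_mktuple ltnSn.
    have := HC m (z m) (z m.+1).
    rewrite zm zm1 => /(_ _)/wrap[|H].
      move=> l lm; rewrite !tnth_mktuple ltnS leq_eqVlt.
      by rewrite (_ : (l == m :> nat) = false)//; apply/negbTE.
    have G : `|mollify_grad m (z m) - mollify_grad m x| <= M * S1.
      rewrite (le_trans (mollify_grad_lipschitz _ _ _))// ler_wpM2l// ler_sum// => l _.
      by rewrite tnth_mktuple; case: ifP => // _; rewrite subrr normr0.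
    rewrite (_ : _ - _ = (mollify (z m.+1) - mollify (z m) -
        (tnth y m - tnth x m) * mollify_grad m (z m)) +
        (tnth y m - tnth x m) * (mollify_grad m (z m) - mollify_grad m x)); last by ring.
    rewrite (le_trans (ler_normD _ _))// lerD// normrM mulrC ler_wpM2r//.
  have tele : mollify y - mollify x =
      \sum_(m < k) (mollify (z m.+1) - mollify (z m)).
    rewrite -(big_mkord xpredT (fun m => mollify (z m.+1) - mollify (z m))).
    rewrite telescope_sumr//; congr (mollify _ - mollify _).
      by apply: eq_from_tnth => l; rewrite tnth_mktuple ltn_ord.
    by apply: eq_from_tnth => l; rewrite tnth_mktuple.
  rewrite tele -sumrB (le_trans (ler_norm_sum _ _ _))//.
  rewrite (le_trans (ler_sum _ (fun m _ => step m)))//.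
  rewrite big_split/= -!mulr_sumr -/S1 /Cg mulrDl lerD2l -!mulrA ler_wpM2l ?invr_ge0 ?(ltW d0)//.
  by rewrite ler_wpM2l// -expr2 sqr_sum_le.
exists Cg; split => //.
- exact: lipschitz1_sum mollify_lipschitz.
- by move=> l; exact: lipschitz_measurable (mollify_grad_lipschitz l).
move=> x v; set V := \sum_l v l ^+ 2.
have V0 : 0 <= V by apply: sumr_ge0 => l _; exact: sqr_ge0.
suff H : `|\sum_l v l * mollify_grad l x| <= Num.sqrt V.
  by rewrite -real_normK ?num_real// -(sqr_sqrtr V0) lerXn2r ?nnegrE// sqrtr_ge0.
(* The derivative along v is tested on the point x + t v: the expansion and the Euclidean Lipschitz
   bound give t |v.D| <= t sqrt V + Cg t^2 V. *)
rewrite -subr_le0; apply: (@le0_small_bound _ _ (Cg * V)) => t t0 t1.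
pose y : k.-tuple R := [tuple tnth x l + t * v l | l < k].
have yx l : tnth y l - tnth x l = t * v l by rewrite tnth_mktuple addrC addKr.
have := expn x y.
under eq_bigr do rewrite yx -mulrA.
under [in leRHS]eq_bigr do rewrite yx exprMn.
rewrite -!mulr_sumr -/V => e1.
have := mollify_lipschitz y x.
rewrite [enorm _](_ : _ = t * Num.sqrt V) => [e2|]; last first.
  rewrite /enorm (eq_bigr (fun l => t ^+ 2 * v l ^+ 2)) => [|l _].
    by rewrite -mulr_sumr sqrtrM ?sqr_ge0// sqrtr_sqr gtr0_norm.
  by rewrite -exprMn -yx tnth_mktuple.
rewrite -(ler_pM2l t0) mulrBr -{1}(gtr0_norm t0) -normrM.
move: e1 e2; set A := t * \sum_l _; set B := mollify y - mollify x => e1 e2.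
have := ler_normB (B - A) B; rewrite (_ : B - A - B = - A) ?normrN; last by ring.
by move=> e3; rewrite lerBlDr (le_trans e3)// lerD// (le_trans e1)// le_eqVlt; apply/orP; left; apply/eqP; ring.
Qed.

End mollify.

(** * Transfer between laws, and assembly *)

Section same_law.
Context d d' d'' (T : measurableType d) (T' : measurableType d')
  (S : measurableType d'') (R : realType).
Variables (P : {measure set T -> \bar R}) (P' : {measure set T' -> \bar R}).
Variables (X : T -> S) (X' : T' -> S).
Hypotheses (mX : measurable_fun setT X) (mX' : measurable_fun setT X').
Hypothesis law : forall A, measurable A -> P (X @^-1` A) = P' (X' @^-1` A).

Lemma ge0_integral_same_law (f : S -> \bar R) : measurable_fun setT f ->
  (forall x, 0 <= f x)%E -> (\int[P]_w f (X w) = \int[P']_w f (X' w))%E.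
Proof.
move=> mf f0.
have h1 := @ge0_integral_pushforward _ _ _ _ R _ mX P setT f measurableT mf (fun y _ => f0 y).
have h2 := @ge0_integral_pushforward _ _ _ _ R _ mX' P' setT f measurableT mf (fun y _ => f0 y).
rewrite !preimage_setT in h1 h2; rewrite -[LHS]h1 -[RHS]h2.
by apply: eq_measure_integral => A mA _; exact: law.
Qed.

(** Integrability is only checked for X'; it is transferred to X through the nonnegative case
    applied to the absolute value. *)
Lemma integral_same_law (f : S -> \bar R) : measurable_fun setT f ->
  P'.-integrable setT (f \o X') ->
  P.-integrable setT (f \o X) /\ (\int[P]_w f (X w) = \int[P']_w f (X' w))%E.
Proof.
move=> mf fi'.
have fi : P.-integrable setT (f \o X).
  apply/integrableP; split; first exact: (measurableT_comp mf mX).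
  have /integrableP[_] := fi'; apply: le_lt_trans.
  have mf' := measurableT_comp (@abse_measurable R setT) mf.
  by rewrite (ge0_integral_same_law mf' (fun x => abse_ge0 (f x))).
split=> //.
have h1 := @integral_pushforward _ _ _ _ R _ mX P setT f mf.
have h2 := @integral_pushforward _ _ _ _ R _ mX' P' setT f mf.
rewrite !preimage_setT in h1 h2.
rewrite -[LHS](h1 fi measurableT) -[RHS](h2 fi' measurableT).
by apply: eq_measure_integral => A mA _; exact: law.
Qed.

End same_law.

Theorem theorem10 (R : realType) (n k : nat)
    (n_ge2 : (2 <= n)%N) (k_ge1 : (1 <= k)%N) (k_le_n : (k <= n)%N)
    (d : measure_display) (T : measurableType d) (P : probability T R)
    (d' : measure_display) (T' : measurableType d') (Q : probability T' R)
    (Y : {RV P >-> n.-tuple R}) (Z : {RV Q >-> k.-tuple R}) (a : R)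
    (Ysym : spherically_symmetric Y)
    (Ynorm : ('E_P[fun w => (tnth (Y w) (Ordinal (ltnW n_ge2)) ^+ 2)%R] = 1%:E)%E)
    (Yvar : ('V_P[fun w => (enorm (Y w) ^+ 2)%R] <= a%:E)%E)
    (Zgauss : standard_gaussian Z) :
  (wasserstein P Q (first_coords k_le_n \o Y) Z
    <= (k%:R * (Num.sqrt a + 2) / (n%:R - 1))%:E)%E.
Proof.
pose mu : probability (n.-tuple R) R := distribution P Y.
pose nu : probability (k.-tuple R) R := distribution Q Z.
(* Only the two laws enter the distance, so Y and Z may be taken independent on the product of their
   value spaces. *)
pose pi' : probability (n.-tuple R * k.-tuple R)%type R := (mu \x nu)%E.
have [Zcoord Zbox] := Zgauss.
have pi_res i A : measurable A ->
    pi' A = (pi' \x @normal_prob R 0 1)%E (resample i @^-1` A).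
  exact (@resample_invariant R n k mu nu Zcoord Zbox i A).
have pi_rot (i j : 'I_n) c s : i != j -> c ^+ 2 + s ^+ 2 = 1 ->
    forall A, measurable A ->
    pi' A = pi' ((fun p : n.-tuple R * k.-tuple R => (plane_rot i j c s p.1, p.2)) @^-1` A).
  by move=> ij cs A; exact (@plane_rot_invariant R n i j c s ij cs k mu nu Ysym A).
have lawY A : measurable A -> P (Y @^-1` A) = pi' (fst @^-1` A).
  move=> mA; transitivity (mu A * nu setT)%E.
    by rewrite (_ : nu setT = 1%E) ?mule1//; exact: probability_setT.
  rewrite -product_measure1E//; congr ((_ \x _)%E _).
  by apply/seteqP; split => [[y z] []|[y z]].
have lawZ A : measurable A -> Q (Z @^-1` A) = pi' (snd @^-1` A).
  move=> mA; transitivity (mu setT * nu A)%E.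
    by rewrite (_ : mu setT = 1%E) ?mul1e//; exact: probability_setT.
  rewrite -product_measure1E//; congr ((_ \x _)%E _).
  by apply/seteqP; split => [[y z] []|[y z]].
have mY : measurable_fun setT Y by [].
have mZ : measurable_fun setT Z by [].
pose X w := enorm (Y w) ^+ 2.
(* [fine] would return 0 for an infinite mean, so c0 is kept as an unknown real. Any real centre
   suffices for the fourth moments; these give integrability of |Y|^2, and only then is c0
   identified with n. *)
pose c0 := fine 'E_P[X].
have VX : 'V_P[X] = (\int[P]_w ((X w - c0) ^+ 2)%:E)%E.
  rewrite /variance unlock unlock; apply: eq_integral => w _.
  by rewrite expr2 /c0 [in RHS]unlock.
have mQ : measurable_fun setT (fun y : n.-tuple R => \sum_(j < n) tnth y j ^+ 2).
  by apply: measurable_sum => j; apply: measurable_funX; exact: measurable_tnth.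
have lawX c : (\int[P]_w ((X w - c) ^+ 2)%:E =
    \int[pi']_p ((sqnorm_fst p - c) ^+ 2)%:E)%E.
  rewrite -(ge0_integral_same_law mY (@measurable_fst _ _ _ _) lawY
    (f := fun y => ((\sum_(j < n) tnth y j ^+ 2 - c) ^+ 2)%:E)).
  - by apply: eq_integral => w _; rewrite /X enorm_sqr.
  - apply/measurable_EFinP; apply: measurable_funX.
    exact: measurable_funB.
  - by move=> y; rewrite lee_fin sqr_ge0.
have pi_fst4 j : pi'.-integrable setT (EFin \o (fun p => tnth p.1 j ^+ 4)).
  have mS : measurable_fun setT (fun p : n.-tuple R * k.-tuple R => sqnorm_fst p).
    by case: (@tame_sqnorm_fst R n k).
  (* Here y_j^4 <= |y|^4 <= 2 (|y|^2 - c0)^2 + 2 c0^2, so the variance bound yields the fourth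
     moments. *)
  apply: (@le_integrableR _ _ _ _ _ (fun p => 2 * (sqnorm_fst p - c0) ^+ 2 + 2 * c0 ^+ 2)).
  - by apply: measurable_funX; exact: measurable_fst_tnth.
  - move=> p; rewrite ger0_norm ?exprn_even_ge0// (_ : _ ^+ 4 = (tnth p.1 j ^+ 2) ^+ 2); last by rewrite -exprM.
    have : (tnth p.1 j ^+ 2) ^+ 2 <= sqnorm_fst p ^+ 2.
      rewrite lerXn2r ?nnegrE ?sqr_ge0//.
        by apply: sumr_ge0 => l _; exact: sqr_ge0.
      by rewrite /sqnorm_fst (bigD1 j)//= lerDl sumr_ge0// => l _; exact: sqr_ge0.
    move=> /le_trans; apply; have := sqr_ge0 (sqnorm_fst p - 2 * c0).
    by rewrite !sqrrB; lra.
  - apply: integrableRD; last exact: integrableR_cst.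
    apply: integrableRZ; apply/integrableP; split.
      apply/measurable_EFinP; apply: measurable_funX; exact: measurable_funB.
    under eq_integral do rewrite /= ger0_norm ?sqr_ge0//.
    by rewrite -lawX -VX (le_lt_trans Yvar)// ltry.
pose it m f (tf : tame m f) (m4 : (m <= 4)%N) := integrable_tame pi_res pi_fst4 tf m4.
have tq j : tame 2 (fun p : n.-tuple R * k.-tuple R => tnth p.1 j ^+ 2).
  exact: (tameX 2 (tame_fst k j)).
have pi_fst2 j : \int[pi']_p (tnth p.1 j ^+ 2) = 1.
  have e0 : \int[pi']_p (tnth p.1 (Ordinal (ltnW n_ge2)) ^+ 2) = 1.
    move: Ynorm; rewrite unlock => Ynorm'.
    rewrite /Rintegral -[RHS]/(fine 1%E) -Ynorm'; congr fine; apply/esym.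
    apply: (ge0_integral_same_law mY (@measurable_fst _ _ _ _) lawY
      (f := fun y => (tnth y (Ordinal (ltnW n_ge2)) ^+ 2)%:E)).
      by apply/measurable_EFinP; apply: measurable_funX; exact: measurable_tnth.
    by move=> y; rewrite lee_fin sqr_ge0.
  have [<-//|ij] := eqVneq (Ordinal (ltnW n_ge2)) j.
  (* A quarter turn carries coordinate j to the normalized coordinate, so all second moments equal
     1. *)
  have cs : 0 ^+ 2 + 1 ^+ 2 = 1 :> R by rewrite expr0n expr1n add0r.
  rewrite -e0 -(E_plane_rot pi_res pi_rot pi_fst4 ij cs (tq (Ordinal (ltnW n_ge2))) isT).
  by apply: eq_RintegralT => p; rewrite tnth_mktuple eqxx mul0r add0r mul1r.
have c0E : c0 = n%:R.
  rewrite /c0 unlock -[RHS]/(fine n%:R%:E); congr fine.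
  have iS := it _ _ (@tame_sqnorm_fst R n k) isT.
  have [|_ XE] := integral_same_law mY (@measurable_fst _ _ _ _) lawY
    (f := fun y => (\sum_(j < n) tnth y j ^+ 2)%:E) _ iS.
    exact/measurable_EFinP.
  transitivity (\int[P]_w (\sum_(j < n) tnth (Y w) j ^+ 2)%:E)%E.
    by apply: eq_integral => w _; rewrite /X enorm_sqr.
  rewrite XE -[LHS]fineK; last exact (integrable_fin_num measurableT iS).
  congr EFin; transitivity (\sum_(j < n) \int[pi']_p (tnth p.1 j ^+ 2)).
    by rewrite -RintegralT_sum// => j; exact: it _ _ (tq j) isT.
  by under eq_bigr do rewrite pi_fst2; rewrite sumr_const card_ord.
have pi_var : \int[pi']_p ((sqnorm_fst p - n%:R) ^+ 2) <= a.
  rewrite -lee_fin /Rintegral fineK.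
    by rewrite -lawX -c0E -VX.
  rewrite -lawX -c0E -VX ge0_fin_numE; last exact: variance_ge0.
  by rewrite (le_lt_trans Yvar)// ltry.
apply: ge_ereal_sup => _ [g gl <-].
have g_lip := lipschitz1_sum gl.
have mg : measurable_fun setT g.
  by apply: (@lipschitz_measurable _ _ _ 1) => x y; rewrite mul1r.
have tg (c s : R) : tame 1 (fun p => g (mix k_le_n c s p)).
  exact: tame_lipschitz g_lip (tame_mix k_le_n c s).
have ig c s := it _ _ (tg c s) isT.
have mfc : measurable_fun setT (first_coords k_le_n : n.-tuple R -> k.-tuple R).
  apply/measurable_fun_tnthP => l.
  rewrite (_ : _ \o _ = (tnth (T:=R))^~ (widen_ord k_le_n l)); first exact: measurable_tnth.
  by apply/funext => y /=; rewrite tnth_mktuple.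
have mix10 : mix k_le_n 1 0 = (fun p : n.-tuple R * k.-tuple R => first_coords k_le_n p.1).
  apply/funext => p; apply: eq_from_tnth => l; rewrite !tnth_mktuple.
  by rewrite mul1r mul0r addr0.
have mix01 : mix k_le_n 0 1 = (fun p : n.-tuple R * k.-tuple R => p.2).
  apply/funext => p; apply: eq_from_tnth => l; rewrite !tnth_mktuple.
  by rewrite mul1r mul0r add0r.
have EY : ('E_P[g \o (first_coords k_le_n \o Y)])%E = (\int[pi']_p g (mix k_le_n 1 0 p))%:E.
  rewrite unlock; have ig' := ig 1 0; rewrite mix10 in ig'.
  rewrite /Rintegral fineK; last by rewrite mix10; exact (integrable_fin_num measurableT ig').
  rewrite mix10.
  have mgf := measurableT_comp mg mfc.
  have mEgf : measurable_fun setT (fun y => (g (first_coords k_le_n y))%:E).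
    exact/measurable_EFinP.
  by have [_ ->] := integral_same_law mY (@measurable_fst _ _ _ _) lawY mEgf ig'.
have EZ : ('E_Q[g \o Z])%E = (\int[pi']_p g (mix k_le_n 0 1 p))%:E.
  rewrite unlock; have ig' := ig 0 1; rewrite mix01 in ig'.
  rewrite /Rintegral fineK; last by rewrite mix01; exact (integrable_fin_num measurableT ig').
  rewrite mix01.
  have mEg : measurable_fun setT (fun y => (g y)%:E) by exact/measurable_EFinP.
  by have [_ ->] := integral_same_law mZ (@measurable_snd _ _ _ _) lawZ mEg ig'.
rewrite EY EZ -EFinB abse_EFin lee_fin -subr_le0.
(* The smoothing scale t costs t times [abs_snd_mean] at each end of the path, hence the factor 2,
   while the bound of [path_bound] does not depend on t. *)
apply: (@le0_small_bound _ _ (2 * abs_snd_mean pi')) => t t0 t1.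
have [Cg gD] := mollify_smooth pi_res pi_fst4 gl t0.
have := path_bound k_le_n pi_res pi_rot pi_fst4 pi_fst2 pi_var k_ge1 n_ge2 gD.
rewrite cos_pihalf sin_pihalf cos0 sin0.
have close c s : `|\int[pi']_p (mollify pi' g t (mix k_le_n c s p)) -
    \int[pi']_p (g (mix k_le_n c s p))| <= t * abs_snd_mean pi'.
  have img := it _ _ (tame_g k_le_n gD c s) isT.
  rewrite -RintegralTB// -(RintegralT_cst pi' (t * _)).
  apply: norm_RintegralT; [exact: integrableRB|exact: integrableR_cst|].
  by move=> p; exact (mollify_close pi_res pi_fst4 gl t0 (mix k_le_n c s p)).
have := close 0 1; have := close 1 0; rewrite !ler_norml.
set u := \int[pi']_p _; set v := \int[pi']_p _.
set u' := \int[pi']_p _; set v' := \int[pi']_p _.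
move=> /andP[h1 h2] /andP[h3 h4] /andP[h5 h6].
rewrite lerBlDr ler_norml; apply/andP; split; lra.
Qed.
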